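(* Let $A\in\mathbb{T}^{d\times m}$ be such that $\bar{A}$ is tropically sign generic. Then $\operatorname{qvol}^+A=\operatorname{qvol}^-A$ (this common value is denoted $\operatorname{qvol}A$), and for every lift $\mathbf{A}$ of $A$, \[\lim_{t\to\infty}\frac{\log\operatorname{vol}\operatorname{conv}\mathbf{A}(t)}{\log t}=\operatorname{qvol}A,\] where $\mathbf{A}(t)$ is the real matrix obtained by evaluating the entries of $\mathbf{A}$ at $t$ and $\operatorname{vol}\operatorname{conv}\mathbf{A}(t)$ is the Euclidean volume of the convex hull of its columns.
   Context: $\mathbb{T}=\mathbb{R}\cup\{-\infty\}$ with $\max$ as addition and $+$ as multiplication. $\mathbb{K}$ is a Hardy field of germs at infinity of real functions of $t$ definable in a fixed polynomially bounded o-minimal structure, containing all $t^r$, $r\in\mathbb{R}$; $\operatorname{val}f=\lim_{t\to\infty}\log|f(t)|/\log t$, $\operatorname{val}0=-\infty$. A lift of $A\in\mathbb{T}^{d\times m}$ is $\mathbf{A}\in\mathbb{K}_{\ge0}^{d\times m}$ with $\operatorname{val}\mathbf{A}=A$ entrywise. For $\mathbf{A}$ over $\mathbb{K}$, $\bar{\mathbf{A}}$ adds a top row of ones and $\operatorname{vol}\mathbf{A}$ is the volume of the convex hull of its columns (sum of $(d!)^{-1}|\det\bar{\mathbf{A}}[J]|$ over maximal simplices $J$ of a triangulation). $\operatorname{qvol}^+A=\sup$ and $\operatorname{qvol}^-A=\inf$ of $\operatorname{val}\operatorname{vol}\mathbf{A}$ over all lifts $\mathbf{A}$ of $A$. For $A$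 over $\mathbb{T}$, $\bar{A}$ is the $(d+1)\times m$ matrix obtained by adding a top row of zeros. A matrix over $\mathbb{T}$ is tropically sign generic if, for every maximal square submatrix $C$, all permutations $\sigma$ attaining $\max_\sigma\sum_i c_{i\sigma(i)}$ have the same parity. *)

(* Defs.v *)
From HB Require Import structures.
From mathcomp Require Import all_boot all_order all_algebra all_fingroup.
From mathcomp Require Import all_classical all_reals all_analysis.

Set Implicit Arguments.
Unset Strict Implicit.
Unset Printing Implicit Defensive.

Import Order.TTheory GRing.Theory Num.Theory.
Import numFieldNormedType.Exports.

Local Open Scope classical_set_scope.
Local Open Scope ring_scope.

(** * O-minimal structures on the real field *)

(* [S n] is the collection of definable subsets of R^n. *)
Definition set_structure (R : realType) := forall n : nat, set (set 'rV[R]_n).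

Definition definable_fun (R : realType) (S : set_structure R) (f : R -> R) :=
  S 2%N [set x | x 0 1 = f (x 0 0)].

(* O-minimal structures expanding the ordered field R, as in van den Dries,
   "Tame topology and o-minimal structures". [interval R] contains the
   singletons [[a, a]] and the unbounded intervals, so that [omin_line] says
   that S 1 consists exactly of the finite unions of intervals and points; in
   particular all real constants are definable. *)
Record o_minimal (R : realType) (S : set_structure R) : Prop := {
  omin_set0 : forall n, S n set0;
  omin_setU : forall n (X Y : set 'rV[R]_n), S n X -> S n Y -> S n (X `|` Y);
  omin_setC : forall n (X : set 'rV[R]_n), S n X -> S n (~` X);
  omin_prodr : forall n (X : set 'rV[R]_n),
    S n X -> S (n + 1)%N [set x | X (lsubmx x)];
  omin_prodl : forall n (X : set 'rV[R]_n),
    S n X -> S (1 + n)%N [set x | X (rsubmx x)];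
  omin_diag : forall n (i j : 'I_n), S n [set x | x 0 i = x 0 j];
  omin_proj : forall n (X : set 'rV[R]_(n + 1)),
    S (n + 1)%N X -> S n [set lsubmx x | x in X];
  omin_lt : S 2%N [set x | x 0 0 < x 0 1];
  omin_add : S 3%N [set x | x 0 2 = x 0 0 + x 0 1];
  omin_mul : S 3%N [set x | x 0 2 = x 0 0 * x 0 1];
  omin_line : forall X : set R, S 1%N [set x | X (x 0 0)] <->
    exists s : seq (interval R), X = [set x | has (fun i => x \in i) s]
}.

Definition polynomially_bounded (R : realType) (S : set_structure R) : Prop :=
  forall f : R -> R, definable_fun S f ->
  exists N : nat, \forall t \near +oo, `|f t| <= t ^+ N.

(** * Hardy fields *)

(* A Hardy field of germs at infinity of functions definable in S which
   contains all real powers of t. It is presented as an ordered field together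
   with a choice [germ_fun f] of a definable representative of each germ f. A
   germ only determines its representatives up to eventual equality, hence all
   identities hold eventually; [germ_le] makes f |-> germ of [germ_fun f]
   injective and gives the field its usual order. Closure under
   differentiation is [germ_derive]. *)
Record hardy_field (R : realType) (S : set_structure R) := HardyField {
  hardy_sort :> realFieldType;
  germ_fun : hardy_sort -> R -> R;
  germ_definable : forall f, definable_fun S (germ_fun f);
  germ_one : \forall t \near +oo, germ_fun 1 t = 1;
  germ_add : forall f g,
    \forall t \near +oo, germ_fun (f + g) t = germ_fun f t + germ_fun g t;
  germ_mul : forall f g,
    \forall t \near +oo, germ_fun (f * g) t = germ_fun f t * germ_fun g t;
  germ_le : forall f g,
    f <= g <-> \forall t \near +oo, germ_fun f t <= germ_fun g t;
  germ_derive : forall f, exists g,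
    \forall t \near +oo, is_derive t (1 : R) (germ_fun f) (germ_fun g t);
  germ_power : forall r : R, exists f,
    \forall t \near +oo, germ_fun f t = t `^ r
}.

(* log y / log t, with log 0 = -oo. *)
Definition log_ratio (R : realType) (y : \bar R) (t : R) : \bar R :=
  (lne y * ((ln t)^-1)%:E)%E.

(* Since log 0 = -oo, this gives [val 0 = -oo]. *)
Definition valuation (R : realType) (S : set_structure R) (K : hardy_field S)
    (f : K) : \bar R :=
  lim (log_ratio `|germ_fun f t|%:E t @[t --> +oo]).

(** * Volume of a polytope over an ordered field *)

(* The convex hull of the columns of M with index in J. *)
Definition hull (F : realFieldType) (d m : nat) (M : 'M[F]_(d, m))
    (J : {set 'I_m}) : set 'cV[F]_d :=
  [set x | exists w : 'I_m -> F,
     [/\ forall j, 0 <= w j, forall j, j \notin J -> w j = 0,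
         \sum_j w j = 1 & x = \sum_j w j *: col j M]].

Definition bar_mx (F : realFieldType) (d m : nat) (M : 'M[F]_(d, m)) :
    'M[F]_(1 + d, m) :=
  col_mx (const_mx 1) M.

Definition affinely_independent (F : realFieldType) (d m : nat)
    (M : 'M[F]_(d, m)) (J : {set 'I_m}) : Prop :=
  \rank (colsub (fun k : 'I_#|J| => enum_val k) (bar_mx M)) = #|J|.

(* Triangulations of the convex hull of the columns of M, with vertices among
   these columns; a simplex is given by the set of indices of its vertices. *)
Record triangulation (F : realFieldType) (d m : nat) (M : 'M[F]_(d, m))
    (T : {set {set 'I_m}}) : Prop := {
  triang_simplex : forall J, J \in T -> affinely_independent M J;
  triang_face : forall J J' : {set 'I_m}, J \in T -> J' \subset J -> J' \in T;
  triang_inter : forall J J', J \in T -> J' \in T ->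
    hull M J `&` hull M J' = hull M (J :&: J');
  triang_cover : hull M [set: 'I_m]%SET = \bigcup_(J in [set` T]) hull M J
}.

(* |det M-bar[J]| when J has d + 1 elements, and 0 otherwise. *)
Definition abs_det (F : realFieldType) (d m : nat) (M : 'M[F]_(d, m))
    (J : {set 'I_m}) : F :=
  match #|J| =P (1 + d)%N with
  | ReflectT eqJ =>
      `|\det (colsub (fun k => enum_val (cast_ord (esym eqJ) k)) (bar_mx M))|
  | ReflectF _ => 0
  end.

(* The sum is independent of the triangulation, one of which is chosen by
   [xget]. Only the simplices with d + 1 vertices contribute: they are the
   maximal ones if the hull is full-dimensional, and there are none
   otherwise. *)
Definition vol (F : realFieldType) (d m : nat) (M : 'M[F]_(d, m)) : F :=
  \sum_(J in xget finset.set0 [set T | triangulation M T])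
    (d`!%:R)^-1 * abs_det M J.

(** * Tropical matrices and quantized volumes *)

(* Elements of T = R u {-oo} are extended reals different from +oo. *)
Definition tropical_mx (R : realType) (d m : nat) (A : 'M[\bar R]_(d, m)) :=
  forall i j, A i j != +oo%E.

Definition trop_bar_mx (R : realType) (d m : nat) (A : 'M[\bar R]_(d, m)) :
    'M[\bar R]_(1 + d, m) :=
  col_mx (const_mx 0%E) A.

Definition trop_weight (R : realType) (n : nat) (C : 'M[\bar R]_n)
    (s : 'S_n) : \bar R :=
  (\sum_(i < n) C i (s i))%E.

Definition trop_det (R : realType) (n : nat) (C : 'M[\bar R]_n) : \bar R :=
  \big[maxe/-oo%E]_(s : 'S_n) trop_weight C s.

(* If [trop_det C = -oo], then every permutation attains the maximum. *)
Definition tropically_sign_generic (R : realType) (p q : nat)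
    (B : 'M[\bar R]_(p, q)) : Prop :=
  forall (f : 'I_(minn p q) -> 'I_p) (g : 'I_(minn p q) -> 'I_q),
  {homo f : i j / (i < j)%N} -> {homo g : i j / (i < j)%N} ->
  let C := mxsub f g B in
  forall s1 s2 : 'S_(minn p q),
  trop_weight C s1 = trop_det C -> trop_weight C s2 = trop_det C ->
  odd_perm s1 = odd_perm s2.

Definition lifts (R : realType) (S : set_structure R) (K : hardy_field S)
    (d m : nat) (A : 'M[\bar R]_(d, m)) : set 'M[K]_(d, m) :=
  [set M | forall i j, 0 <= M i j /\ valuation (M i j) = A i j].
Arguments lifts {R S} K {d m} A _.

Definition qvol_sup (R : realType) (S : set_structure R) (K : hardy_field S)
    (d m : nat) (A : 'M[\bar R]_(d, m)) : \bar R :=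
  ereal_sup [set valuation (vol M) | M in lifts K A].

Definition qvol_inf (R : realType) (S : set_structure R) (K : hardy_field S)
    (d m : nat) (A : 'M[\bar R]_(d, m)) : \bar R :=
  ereal_inf [set valuation (vol M) | M in lifts K A].

(** * Euclidean volume *)

Definition box (R : realType) (d : nat) (a b : 'cV[R]_d) : set 'cV[R]_d :=
  [set x | forall i, a i 0 <= x i 0 <= b i 0].

Definition box_vol (R : realType) (d : nat) (a b : 'cV[R]_d) : R :=
  \prod_i Num.max 0 (b i 0 - a i 0).

(* The Lebesgue outer measure on R^d: the infimum of the total volumes of the
   countable covers by boxes. Covers are indexed by subsets of nat so that the
   empty set has volume 0 for d = 0 too. *)
Definition euclidean_vol (R : realType) (d : nat) (X : set 'cV[R]_d) : \bar R :=
  ereal_inf [set v | exists (D : set nat) (a b : nat -> 'cV[R]_d),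
    X `<=` \bigcup_(k in D) box (a k) (b k) /\
    v = (\esum_(k in D) (box_vol (a k) (b k))%:E)%E].

Definition eval_mx (R : realType) (S : set_structure R) (K : hardy_field S)
    (d m : nat) (M : 'M[K]_(d, m)) (t : R) : 'M[R]_(d, m) :=
  map_mx (fun f : K => germ_fun f t) M.

(* Main.v *)
Require Import Defs.
From HB Require Import structures.
From mathcomp Require Import all_boot all_order all_algebra all_fingroup.
From mathcomp Require Import all_classical all_reals all_analysis.
From mathcomp Require Import measurable_realfun ring lra.

Set Implicit Arguments.
Unset Strict Implicit.
Unset Printing Implicit Defensive.

Import Order.TTheory GRing.Theory Num.Theory.
Import numFieldNormedType.Exports.

Local Open Scope classical_set_scope.
Local Open Scope ring_scope.

(** Up to constant factors, which are invisible to log / log t, both the volume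
    over K and the Euclidean volume of the evaluated polytope equal the sum D of
    the absolute values of the maximal minors of the bar matrix. Sign genericity
    prevents cancellation between the even and the odd terms of each minor, so
    the valuation of D is the maximum of the tropical minors of the bar matrix of
    A, whatever the lift.

    Over K: sign genericity puts the points in general position, so a regular
    triangulation exists, and a pigeonhole argument on rational points of a
    simplex shows that a triangulation contains a simplex which is at least as
    large, up to a natural number, as a given one.

    Over the reals: the hull is squeezed between two parallelotopes spanned by
    the edges of its largest simplex, and pivoted Gaussian elimination reduces
    the outer measure of a parallelotope, up to constants, to one dimension
    less. *)

(** * Minors and barycentric coordinates *)

(** Neither volume is computed, and no triangulation is carried from K to the reals. D mediates
    because it is a finite expression in the entries: forming it over K and evaluating at t, or
    evaluating first, agree eventually. The two comparisons differ in uniformity. Over K the matrix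
    is one fixed object, so the constant may depend on it, but it must be a natural number, since
    these are what every positive power of t absorbs. Over the reals the matrix moves with t, so the
    constants may depend on d and m only. As [vol] uses a triangulation picked by choice, the
    pigeonhole estimate is proved for any cover of the hull by simplices, and the regular
    triangulation serves only to certify that the picked object is a triangulation. With at most d
    columns, D is 0 and every valuation in sight is -oo. *)

Lemma enum_val_imset (n m : nat) (f : 'I_n -> 'I_m)
    (e : #|[set f i | i : 'I_n]%SET| = n) : injective f ->
  exists s : 'S_n, forall i, enum_val (cast_ord (esym e) i) = f (s i).
Proof.
move=> fI; pose h i := enum_val (cast_ord (esym e) i).
have hP i : exists j, h i == f j.
  have /imsetP[j _ E] := enum_valP (cast_ord (esym e) i).
  by exists j; apply/eqP.
pose g i := xchoose (hP i).
have gE i : h i = f (g i) by apply/eqP; exact: (xchooseP (hP i)).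
have gI : injective g.
  move=> i j /(congr1 f); rewrite -!gE => /enum_val_inj.
  exact: cast_ord_inj.
by exists (perm gI) => i; rewrite permE -gE.
Qed.

Lemma abs_det_imset (F : realFieldType) (d m : nat) (M : 'M[F]_(d, m))
    (f : 'I_(1 + d) -> 'I_m) : injective f ->
  abs_det M [set f i | i : 'I_(1 + d)]%SET = `|\det (colsub f (bar_mx M))|.
Proof.
move=> fI; rewrite /abs_det; case: eqP => [e|]; last first.
  by rewrite card_imset // card_ord.
have [s sE] := enum_val_imset e fI.
have -> : colsub (fun k => enum_val (cast_ord (esym e) k)) (bar_mx M)
    = col_perm s (colsub f (bar_mx M)).
  by apply/matrixP => i j; rewrite !mxE sE.
by rewrite col_permE det_mulmx det_perm normrM normrX normrN1 expr1n mulr1.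
Qed.

Lemma abs_det_enum (F : realFieldType) (d m : nat) (M : 'M[F]_(d, m))
    (J : {set 'I_m}) : #|J| = (1 + d)%N ->
  exists2 f : 'I_(1 + d) -> 'I_m, injective f & [set f i | i : 'I_(1 + d)]%SET = J.
Proof.
move=> e; pose f i := enum_val (cast_ord (esym e) i) : 'I_m.
have fI : injective f by move=> i j /enum_val_inj/cast_ord_inj.
exists f => //; apply/eqP; rewrite eqEcard card_imset // card_ord e leqnn andbT.
by apply/fintype.subsetP => _ /imsetP[i _ ->]; apply: enum_valP.
Qed.

Lemma abs_det_neq (F : realFieldType) (d m : nat) (M : 'M[F]_(d, m))
    (J : {set 'I_m}) : #|J| <> (1 + d)%N -> abs_det M J = 0.
Proof. by rewrite /abs_det; case: eqP. Qed.

Lemma abs_det_ge0 (F : realFieldType) (d m : nat) (M : 'M[F]_(d, m))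
    (J : {set 'I_m}) : 0 <= abs_det M J.
Proof. by rewrite /abs_det; case: eqP. Qed.

Definition fupd (n m : nat) (f : 'I_n -> 'I_m) (i : 'I_n) (k : 'I_m) :=
  fun j => if j == i then k else f j.

Lemma fupd_inj (n m : nat) (f : 'I_n -> 'I_m) i k :
  injective f -> (forall j, f j != k) -> injective (fupd f i k).
Proof.
move=> fI fk x y; rewrite /fupd.
case: eqP => [->|_]; case: eqP => [->|_] //.
- by move=> e; move: (fk y); rewrite e eqxx.
- by move=> e; move: (fk x); rewrite e eqxx.
- exact: fI.
Qed.

(** Cramer's rule as an exchange rule: the coordinates of a column in the basis selected by [f] are
    quotients of maximal minors. Under general position they are therefore nonzero outside the
    basis; for a basis of largest minor they are bounded by 1. *)
Lemma cramer_fupd (F : fieldType) (n m : nat) (B : 'M[F]_(n, m)) (f : 'I_n -> 'I_m)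
    (i : 'I_n) (k : 'I_m) : colsub f B \in unitmx ->
  \det (colsub (fupd f i k) B) =
  (invmx (colsub f B) *m B) i k * \det (colsub f B).
Proof.
move=> fU; set l := invmx _ *m B.
(* [E] is the identity with column [i] replaced by the coordinates of column [k], so its determinant
   is [l i k]. *)
pose E : 'M[F]_n := \matrix_(a, b) if b == i then l a k else (a == b)%:R.
have -> : colsub (fupd f i k) B = colsub f B *m E.
  apply/matrixP => a b; rewrite /fupd !mxE.
  case: (b =P i) => [->|/eqP ne].
    transitivity ((colsub f B *m l) a k); first by rewrite mulKVmx.
    by rewrite mxE; apply: eq_bigr => j _; rewrite [E _ _]mxE eqxx.
  rewrite (bigD1 b) //= !mxE (negPf ne) eqxx mulr1 big1 ?addr0// => j jb.
  by rewrite !mxE (negPf ne) (negPf jb) mulr0.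
rewrite det_mulmx mulrC; congr (_ * _).
rewrite (expand_det_row _ i) (bigD1 i) //= big1 ?addr0 => [|j ji].
  rewrite [E i i]mxE eqxx /cofactor -signr_odd addnn odd_double mul1r.
  rewrite [X in \det X](_ : _ = 1%:M) ?det1 ?mulr1//.
  apply/matrixP => a b; rewrite !mxE eq_sym (negPf (neq_lift _ _)).
  by rewrite (inj_eq lift_inj).
by rewrite mxE (negPf ji) eq_sym (negPf ji) mul0r.
Qed.

Lemma mulVmx_colsub (F : comUnitRingType) (n m : nat) (B : 'M[F]_(n, m))
    (f : 'I_n -> 'I_m) i j : colsub f B \in unitmx ->
  (invmx (colsub f B) *m B) i (f j) = (i == j)%:R.
Proof.
move=> /mulVmx/matrixP/(_ i j).
by rewrite !mxE => <-; apply: eq_bigr => l _; rewrite !mxE.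
Qed.

Definition edge_mx (F : zmodType) (d m n : nat) (M : 'M[F]_(d, m))
    (f : 'I_(1 + n) -> 'I_m) : 'M[F]_(d, n) :=
  \matrix_(i, j) (M i (f (rshift 1 j)) - M i (f ord0)).

Lemma colsub_bar_mx (F : realFieldType) (d m n : nat) (M : 'M[F]_(d, m))
    (f : 'I_(1 + n) -> 'I_m) :
  colsub f (bar_mx M) = block_mx 1%:M (const_mx 1) (col (f ord0) M)
    (edge_mx M f + col (f ord0) M *m const_mx 1).
Proof.
apply/matrixP => i j; rewrite [LHS]mxE /bar_mx.
case: (split_ordP i) => i' ->; case: (split_ordP j) => j' ->.
- by rewrite col_mxEu block_mxEul !mxE !ord1.
- by rewrite col_mxEu block_mxEur !mxE.
- rewrite col_mxEd block_mxEdl !mxE ord1; congr (M _ (f _)).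
  exact: val_inj.
- by rewrite col_mxEd block_mxEdr !mxE big_ord1 !mxE mulr1 subrK.
Qed.

(** Passage between edge and barycentric coordinates: the vertex [f ord0] receives what the edge
    coordinates leave of the total weight 1. *)
Lemma mul_colsub_bar_mx (F : realFieldType) (d m n : nat) (M : 'M[F]_(d, m))
    (f : 'I_(1 + n) -> 'I_m) (t : 'cV[F]_n) :
  colsub f (bar_mx M) *m col_mx (1%:M - const_mx 1 *m t) t =
  col_mx (const_mx 1) (col (f ord0) M + edge_mx M f *m t).
Proof.
rewrite colsub_bar_mx mul_block_col mul1mx subrK; congr col_mx.
  by apply/matrixP => i j; rewrite !mxE !ord1.
by rewrite mulmxBr mulmx1 mulmxDl mulmxA [edge_mx _ _ *m _ + _]addrC addrA subrK.
Qed.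

Lemma det_bar_mx (F : realFieldType) (d m : nat) (M : 'M[F]_(d, m))
    (f : 'I_(1 + d) -> 'I_m) :
  \det (colsub f (bar_mx M)) = \det (edge_mx M f).
Proof.
pose U : 'M[F]_(1 + d) := block_mx 1%:M (- const_mx 1) 0 1%:M.
have UE : \det U = 1 by rewrite det_ublock !det1 mulr1.
rewrite -[LHS]mulr1 -UE -det_mulmx colsub_bar_mx.
rewrite mulmx_block !mulmx0 !mul1mx !mulmx1 !addr0 addNr det_lblock det1 mul1r.
by rewrite mulmxN addrC addrK.
Qed.

(** * Regular triangulations *)

Definition general_position (F : realFieldType) (d m : nat) (M : 'M[F]_(d, m)) :=
  forall f : 'I_(1 + d) -> 'I_m, injective f -> \det (colsub f (bar_mx M)) != 0.

Lemma poly_nat_nonroot (F : realFieldType) (p : {poly F}) : p != 0 ->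
  exists n : nat, p.[n%:R] != 0.
Proof.
move=> p0; apply: contrapT => /forallNP h.
pose s := [seq n%:R : F | n <- iota 0 (size p)].
have: (size s < size p)%N.
  apply: max_poly_roots => //.
    by apply/allP => _ /mapP[n _ ->]; apply/negPn/negP => /h.
  rewrite map_inj_uniq ?iota_uniq//.
  by move=> i j /eqP; rewrite eqr_nat => /eqP.
by rewrite size_map size_iota ltnn.
Qed.

Lemma polys_nat_nonroot (F : realFieldType) (I : finType) (P : pred I)
    (p : I -> {poly F}) :
  (forall i, P i -> p i != 0) ->
  exists n : nat, forall i, P i -> (p i).[n.+1%:R] != 0.
Proof.
move=> h; pose q := 'X * \prod_(i | P i) p i.
have [|n] := @poly_nat_nonroot F q.
  rewrite mulf_neq0 ?polyX_eq0//; apply/prodf_neq0 => i; exact: h.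
rewrite /q hornerM hornerX; case: n => [|n]; first by rewrite mul0r eqxx.
rewrite mulf_eq0 negb_or => /andP[_ hn]; exists n => i Pi.
by move: hn; rewrite horner_prod => /prodf_neq0; exact.
Qed.

Lemma mul_bar_mx (F : realFieldType) (d m : nat) (M : 'M[F]_(d, m))
    (w : 'cV[F]_m) :
  bar_mx M *m w = col_mx (const_mx (\sum_j w j 0)) (\sum_j w j 0 *: col j M).
Proof.
rewrite mul_col_mx; congr col_mx; apply/matrixP => i j; rewrite !mxE ?summxE.
  by apply: eq_bigr => l _; rewrite mxE mul1r ord1.
by apply: eq_bigr => l _; rewrite !mxE mulrC ord1.
Qed.

Lemma hull_barP (F : realFieldType) (d m : nat) (M : 'M[F]_(d, m))
    (J : {set 'I_m}) (x : 'cV[F]_d) : hull M J x <->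
  exists w : 'cV[F]_m, [/\ forall j, 0 <= w j 0,
    forall j, j \notin J -> w j 0 = 0 & bar_mx M *m w = col_mx (const_mx 1) x].
Proof.
split=> [[w [w0 wJ w1 ->]]|[w [w0 wJ wE]]].
  exists (\col_j w j); split=> [j|j jJ|]; [by rewrite mxE|by rewrite mxE wJ|].
  rewrite mul_bar_mx; congr col_mx; last first.
    by apply: eq_bigr => l _; rewrite mxE.
  by congr const_mx; rewrite -[RHS]w1; apply: eq_bigr => l _; rewrite mxE.
move: wE; rewrite mul_bar_mx => /eq_col_mx[/matrixP/(_ 0 0)]; rewrite !mxE => w1 xE.
by exists (fun j => w j 0); split.
Qed.

(** Pushforward of weights along [f]; it turns coordinates with respect to a simplex into weights on
    all columns, the format of [hull]. *)
Definition spread (F : nmodType) (n m : nat) (f : 'I_n -> 'I_m) (u : 'cV[F]_n) :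
  'cV[F]_m := \col_j \sum_(i | f i == j) u i 0.

Lemma mulmx_spread (F : pzSemiRingType) (p n m : nat) (f : 'I_n -> 'I_m)
    (B : 'M[F]_(p, m)) (u : 'cV[F]_n) : B *m spread f u = colsub f B *m u.
Proof.
apply/matrixP => a b; rewrite (ord1 b) !mxE.
under [LHS]eq_bigr do rewrite mxE mulr_sumr.
rewrite (exchange_big_dep xpredT)//=; apply: eq_bigr => k _.
by rewrite (big_pred1 (f k)) ?mxE// => j; rewrite /= eq_sym.
Qed.

Section Triangulation.
Variables (F : realFieldType) (d m : nat) (M : 'M[F]_(d, m)).
Hypothesis gp : general_position M.
Let B := bar_mx M.

(* The affine function taking the value [h j] at the column [j] for every [j]
   in the image of [f], as a linear form on the columns of the bar matrix. *)
Let form (h : 'rV[F]_m) (f : 'I_(1 + d) -> 'I_m) : 'rV[F]_(1 + d) :=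
  colsub f h *m invmx (colsub f B).

(** Genericity of the heights at [f]: no further lifted column lies on the hyperplane through the
    lifted vertices of [f]. *)
Let tight (h : 'rV[F]_m) (f : 'I_(1 + d) -> 'I_m) :=
  forall k, k \notin codom f -> (form h f *m B) 0 k != h 0 k.

Let unit_colsub (f : 'I_(1 + d) -> 'I_m) : injective f -> colsub f B \in unitmx.
Proof. by move=> fI; rewrite unitmxE unitfE gp. Qed.

Let form_colsub h f : injective f -> form h f *m colsub f B = colsub f h.
Proof. by move=> fI; rewrite mulmxKV ?unit_colsub. Qed.

Let formE h f i : injective f -> (form h f *m B) 0 (f i) = h 0 (f i).
Proof.
move=> fI; move: (form_colsub h fI) => /matrixP/(_ 0 i).
by rewrite !mxE => <-; apply: eq_bigr => j _; rewrite !mxE.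
Qed.

Let bary (f : 'I_(1 + d) -> 'I_m) : 'M[F]_(1 + d, m) := invmx (colsub f B) *m B.

Let bary_neq0 f i k : injective f -> k \notin codom f -> bary f i k != 0.
Proof.
move=> fI kf; have := @cramer_fupd _ _ _ B f i k (unit_colsub fI).
have /gp : injective (fupd f i k).
  apply: fupd_inj => // j; apply: contra kf => /eqP <-; exact: codom_f.
by move=> + E; rewrite E mulf_eq0 negb_or => /andP[].
Qed.

Let bary_id f i j : injective f -> bary f i (f j) = (i == j)%:R.
Proof. by move=> fI; rewrite mulVmx_colsub ?unit_colsub. Qed.

Let form_bary h f k : (form h f *m B) 0 k = \sum_i h 0 (f i) * bary f i k.
Proof. by rewrite -mulmxA mxE; apply: eq_bigr => i _; rewrite mxE. Qed.

(** The heights are distinct monomials off [f0], evaluated at a natural number that avoids the roots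
    of all the defects [p]. A defect is a nonzero polynomial: if [k] is off [f0], its own monomial
    has coefficient -1; otherwise [f] has a vertex off [f0], whose monomial has a nonzero coordinate
    of [k] as coefficient. Vanishing on [f0] provides a first lower simplex. *)
Lemma generic_heights (f0 : 'I_(1 + d) -> 'I_m) : injective f0 ->
  exists h : 'rV[F]_m, [/\ forall i, h 0 (f0 i) = 0, forall k, 0 <= h 0 k &
    forall f, injective f -> tight h f].
Proof.
move=> f0I.
pose H k : {poly F} := if k \in codom f0 then 0 else 'X^(k.+1).
pose p (x : {ffun 'I_(1 + d) -> 'I_m} * 'I_m) : {poly F} :=
  \sum_i (bary x.1 i x.2) *: H (x.1 i) - H x.2.
have [x|n hn] := @polys_nat_nonroot F _
    (fun x : {ffun 'I_(1 + d) -> 'I_m} * 'I_m =>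
       injectiveb x.1 && (x.2 \notin codom x.1)) p.
  case: x => f k /= /andP[/injectiveP fI kf].
  have csum l : (\sum_i bary f i k *: H (f i))`_l.+1 =
      \sum_(i | (f i \notin codom f0) && (f i == l :> nat)) bary f i k.
    rewrite coef_sum [RHS]big_mkcond; apply: eq_bigr => i _.
    rewrite coefZ /H; case: (f i \in codom f0); first by rewrite coef0 mulr0.
    by rewrite coefXn eqSS eq_sym /=; case: eqP; rewrite ?mulr1 ?mulr0.
  have [kf0|kf0] := boolP (k \in codom f0).
    have [i fi] : exists i, f i \notin codom f0.
      apply: contrapT => /forallNP h.
      have h' i : f i \in codom f0 by apply/negPn/negP => /h.
      have /subset_cardP : #|codom f| = #|codom f0| by rewrite !card_codom.
      move=> /(_ _) E; have/E : codom f \subset codom f0.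
        by apply/fintype.subsetP => _ /codomP[i ->].
      by move=> /(_ k); rewrite kf0 (negPf kf).
    apply/eqP => /(congr1 (fun q : {poly F} => q`_(f i).+1)).
    have Hk : H k = 0 by rewrite /H kf0.
    rewrite /p /= coefB csum Hk coef0 subr0.
    rewrite (big_pred1 i) => [/eqP|j /=].
      by apply/negP; apply: bary_neq0.
    apply/andP/eqP => [[_ /eqP/val_inj/fI //]|->]; by rewrite fi eqxx.
  apply/eqP => /(congr1 (fun q : {poly F} => q`_k.+1)).
  have Hk : H k = 'X^(k.+1) by rewrite /H (negPf kf0).
  rewrite /p /= coefB csum Hk coefXn eqxx big_pred0 => [/eqP|j].
    by rewrite sub0r coef0 oppr_eq0 oner_eq0.
  apply/negbTE/negP => /andP[_ /eqP/val_inj fj].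
  by move: kf; rewrite -fj codom_f.
exists (\row_k (H k).[n.+1%:R]); split.
- by move=> i; rewrite mxE /H codom_f horner0.
- move=> k; rewrite mxE /H; case: ifP; rewrite ?horner0// hornerXn => _.
  by rewrite exprn_ge0.
move=> f fI k kf.
have Ef i : [ffun i => f i] i = f i by rewrite ffunE.
have ffE : [ffun i => f i] = f :> (_ -> _) by apply/funext.
have := hn ([ffun i => f i], k); rewrite /p /= hornerD hornerN horner_sum.
rewrite subr_eq0 form_bary mxE ffE => /(_ _)/negP h; apply/negP => E; apply: h.
  by apply/andP; split => //; apply/injectiveP.
rewrite -(eqP E); apply/eqP; apply: eq_bigr => i _.
by rewrite hornerZ mxE mulrC.
Qed.

(** Lower facets of the lifted columns, or dual feasible bases of the linear program that minimizes
    [h *m w] over the nonnegative [w] with [B *m w] prescribed. *)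
Let feasible (h : 'rV[F]_m) (f : 'I_(1 + d) -> 'I_m) :=
  injectiveb f && [forall k, (form h f *m B) 0 k <= h 0 k].

Let reg (h : 'rV[F]_m) : {set {set 'I_m}} :=
  [set J : {set 'I_m} | [exists f : {ffun 'I_(1 + d) -> 'I_m},
     feasible h f && (J \subset codom f)]]%SET.

Lemma inj_supp (f : 'I_(1 + d) -> 'I_m) (w w' : 'cV[F]_m) : injective f ->
  (forall j, j \notin codom f -> w j 0 = 0) ->
  (forall j, j \notin codom f -> w' j 0 = 0) -> B *m w = B *m w' -> w = w'.
Proof.
move=> fI wf wf' E; apply/matrixP => j k; rewrite {k}ord1.
suff rE (v : 'cV[F]_m) : (forall j, j \notin codom f -> v j 0 = 0) ->
    B *m v = colsub f B *m \col_i v (f i) 0.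
  move: E; rewrite rE// [in RHS]rE// => /(congr1 (mulmx (invmx (colsub f B)))).
  rewrite !mulKmx ?unit_colsub// => /matrixP E.
  have [/codomP[i ->]|jf] := boolP (j \in codom f); last by rewrite wf// wf'.
  by move: (E i 0); rewrite !mxE.
move=> vf; apply/matrixP => a b; rewrite {b}ord1 !mxE.
rewrite (bigID (mem (codom f))) /= [X in _ + X]big1 ?addr0; last first.
  by move=> i /vf ->; rewrite mulr0.
rewrite -big_uniq /=; last by apply/injectiveP.
by rewrite big_map big_enum; apply: eq_bigr => i _; rewrite !mxE.
Qed.

Lemma affinely_independent_sub (f : 'I_(1 + d) -> 'I_m) (J : {set 'I_m}) :
  injective f -> J \subset codom f -> affinely_independent M J.
Proof.
move=> fI /fintype.subsetP Jf; rewrite /affinely_independent.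
apply/eqP; rewrite -[_ == _]/(_ == _) -mxrank_tr -/(row_free _).
rewrite -kermx_eq0; apply/rowV0P => v /sub_kermxP vE.
pose w := spread (@enum_val _ (mem J)) v^T.
have wE k : w (enum_val k) 0 = v 0 k.
  by rewrite mxE (big_pred1 k) ?mxE// => l /=; rewrite (inj_eq enum_val_inj).
have w0 : w = 0.
  apply: (@inj_supp f) => // [j jf|j _|]; rewrite ?mxE// ?mulmx0.
    rewrite big_pred0// => k; apply/negbTE; apply: contra jf => /eqP <-.
    by apply: Jf; exact: enum_valP.
  by rewrite mulmx_spread -[LHS]trmxK trmx_mul trmxK vE trmx0.
by apply/matrixP => a k; rewrite (ord1 a) -wE w0 !mxE.
Qed.

(** Complementary slackness. If [w] on [f] and [w'] on [g] represent the same point, the affine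
    functions of the two lower simplices give [h *m w <= h *m w'] and conversely. Equality forces
    [w'] to live where the function of [f] attains the heights, which by [tight] is on [f];
    uniqueness of coordinates then gives [w = w']. *)
Lemma reg_inter h J J' : (forall f, injective f -> tight h f) ->
  J \in reg h -> J' \in reg h -> hull M J `&` hull M J' = hull M (J :&: J').
Proof.
move=> ht; rewrite !inE.
move=> /existsP[f /andP[/andP[/injectiveP fI /forallP fh] /fintype.subsetP Jf]].
move=> /existsP[g /andP[/andP[/injectiveP gI /forallP gh] /fintype.subsetP Jg]].
rewrite eqEsubset; split => x; last first.
  by move=> [w [w0 wJ w1 wx]]; split; exists w; split => // j jJ; apply: wJ;
    rewrite inE negb_and jJ ?orbT.
move=> [/hull_barP[w [w0 wJ wx]] /hull_barP[w' [w0' wJ' wx']]].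
have val (u u' : 'I_(1 + d) -> 'I_m) (v : 'cV[F]_m) : injective u ->
    (forall j, j \notin codom u -> v j 0 = 0) ->
    (form h u *m B *m v) = h *m v.
  move=> uI vu; apply/matrixP => a b; rewrite !ord1 !mxE.
  apply: eq_bigr => j _.
  have [/codomP[i ->]|/vu->] := boolP (j \in codom u); last by rewrite !mulr0.
  by rewrite formE.
have ws j : j \notin codom f -> w j 0 = 0.
  by move=> jf; apply: wJ; apply: contra jf; exact: Jf.
have ws' j : j \notin codom g -> w' j 0 = 0.
  by move=> jg; apply: wJ'; apply: contra jg; exact: Jg.
have le (u : 'I_(1 + d) -> 'I_m) (v : 'cV[F]_m) :
    (forall k, (form h u *m B) 0 k <= h 0 k) -> (forall j, 0 <= v j 0) ->
    (form h u *m B *m v) 0 0 <= (h *m v) 0 0.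
  move=> uh v0; rewrite [leLHS]mxE [leRHS]mxE; apply: ler_sum => j _.
  exact: ler_wpM2r.
have E : (form h f *m B *m w') 0 0 = (h *m w') 0 0.
  apply/eqP; rewrite eq_le le//=.
  rewrite -(val g g w')// -mulmxA wx' -wx mulmxA.
  apply: (le_trans (le g w gh w0)).
  by rewrite -(val f f w)// -!mulmxA wx wx'.
have ws'f j : j \notin codom f -> w' j 0 = 0.
  move=> jf; apply/eqP; rewrite eq_le w0' andbT leNgt; apply/negP => wj.
  suff : (form h f *m B *m w') 0 0 < (h *m w') 0 0 by rewrite E ltxx.
  rewrite [ltLHS]mxE [ltRHS]mxE (bigD1 j)//= [ltRHS](bigD1 j)//=.
  apply: ltr_leD.
    by rewrite ltr_pM2r// lt_neqAle fh andbT; apply: ht.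
  by apply: ler_sum => k _; apply: ler_wpM2r.
have ww : w = w' by apply: (inj_supp fI) => //; rewrite wx wx'.
apply/hull_barP; exists w; split => // j; rewrite inE negb_and => /orP[/wJ//|].
by rewrite ww; exact: wJ'.
Qed.

(** Dual simplex method: among the finitely many lower simplices, one whose affine function is
    largest at [x] must contain [x], since a negative coordinate of [x] would allow a pivot that
    strictly increases this value. *)
Lemma reg_cover h (f0 : 'I_(1 + d) -> 'I_m) : injective f0 -> feasible h f0 ->
  (forall f, injective f -> tight h f) ->
  hull M [set: 'I_m]%SET = \bigcup_(J in [set` reg h]) hull M J.
Proof.
move=> f0I f0h ht; rewrite eqEsubset; split => x; last first.
  by move=> [J _ [w [w0 wJ w1 wx]]]; exists w; split => // j; rewrite inE.
move=> /hull_barP[w [w0 _ wx]].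
pose X : 'cV[F]_(1 + d) := col_mx (const_mx 1) x.
have ffE (f : 'I_(1 + d) -> 'I_m) : [ffun i => f i] = f :> (_ -> _).
  by apply/funext => i; rewrite ffunE.
have f0h' : feasible h [ffun i => f0 i] by rewrite ffE.
pose cost (f : {ffun 'I_(1 + d) -> 'I_m}) := (form h f *m X) 0 0.
have [f fh fmax] := @arg_maxP _ _ _ [ffun i => f0 i]
  (fun f : {ffun _ -> _} => feasible h f) cost f0h'.
have /andP[/injectiveP fI /forallP fle] := fh.
pose l := invmx (colsub f B) *m X.
have [lge0|] := boolP [forall i, 0 <= l i 0].
  exists [set f i | i : 'I_(1 + d)]%SET => /=.
    rewrite inE; apply/existsP; exists f; rewrite fh /=.
    by apply/fintype.subsetP => _ /imsetP[i _ ->]; exact: codom_f.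
  apply/hull_barP; exists (spread f l); split => [j|j jf|].
  - by rewrite mxE; apply: sumr_ge0 => i _; apply: (forallP lge0).
  - rewrite mxE big_pred0// => i; apply/negbTE; apply: contra jf => /eqP <-.
    by apply/imsetP; exists i.
  by rewrite -/X -/B mulmx_spread mulKVmx ?unit_colsub.
rewrite negb_forall => /existsP[i]; rewrite -ltNge => li.
(* Lowering the value at the vertex [f i] increases the value at [x]; the first
   column that becomes tight replaces [f i]. *)
have lE : l i 0 = \sum_j bary f i j * w j 0.
  by rewrite /l /X -wx mulmxA mxE.
have [k0 k0P] : exists k, bary f i k < 0.
  apply: contrapT => /forallNP hk; move: li; rewrite lE ltNge => /negP; apply.
  by apply: sumr_ge0 => j _; rewrite mulr_ge0// leNgt; apply/negP/hk.
(* Ratio test: how far the value at [f i] can be lowered before the affine function reaches the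
   height of column [k]. *)
pose ratio k := (h 0 k - (form h f *m B) 0 k) / - bary f i k.
have [k kP kmin] := @arg_minP _ _ _ k0 (fun k => bary f i k < 0) ratio k0P.
have kf : k \notin codom f.
  apply/negP => /codomP[j kj]; move: kP; rewrite kj bary_id// => /lt_geF.
  by rewrite ler0n.
pose t := ratio k.
have t0 : 0 < t.
  rewrite divr_gt0 ?oppr_gt0// subr_gt0 lt_neqAle fle andbT.
  exact: ht.
pose phi := form h f - t *: row i (invmx (colsub f B)).
have phiE j : (phi *m B) 0 j = (form h f *m B) 0 j - t * bary f i j.
  rewrite mulmxBl -scalemxAl -row_mul -/(bary f).
  by move: (form h f *m B) (bary f) => C1 C2; rewrite !mxE.
have phile j : (phi *m B) 0 j <= h 0 j.
  rewrite phiE; have [bj|bj] := ltP (bary f i j) 0.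
    by have := kmin j bj; rewrite -/t /ratio ler_pdivlMr ?oppr_gt0// mulrN lerBrDl.
  by apply: (le_trans _ (fle j)); rewrite gerBl mulr_ge0// ltW.
pose g := [ffun j => fupd f i k j].
have gE : g = fupd f i k :> (_ -> _) by rewrite ffE.
have gI : injective g.
  rewrite gE; apply: fupd_inj => // j; apply: contra kf => /eqP <-.
  exact: codom_f.
have gphi : form h g = phi.
  apply: (can_inj (mulmxK (unit_colsub gI))); rewrite form_colsub//.
  apply/matrixP => a j; rewrite (ord1 a).
  transitivity ((phi *m B) 0 (g j)); last first.
    by rewrite !mxE; apply: eq_bigr => c _; rewrite !mxE.
  rewrite phiE mxE gE /fupd; case: (j =P i) => [_|/eqP ji].
    rewrite /t /ratio invrN mulrN mulNr opprK divfK ?lt_eqF//.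
    by rewrite addrC subrK.
  by rewrite formE// bary_id// eq_sym (negPf ji) mulr0 subr0.
have /fmax : feasible h g.
  by apply/andP; split; [apply/injectiveP|apply/forallP => j; rewrite gphi].
(* The pivot changes the cost by [- t * l i 0], which is positive as [t > 0] and [l i 0 < 0]; this
   contradicts maximality. *)
have entryE (c : 'M[F]_1) (u : 'cV[F]_(1 + d)) :
    (c - t *: row i u) 0 0 = c 0 0 - t * u i 0 by rewrite !mxE.
rewrite /cost gphi mulmxBl -scalemxAl -row_mul -/l entryE /Order.ge/= gerBl.
by rewrite pmulr_rge0// => /(lt_le_trans li); rewrite ltxx.
Qed.

Lemma triangulation_exists (f0 : 'I_(1 + d) -> 'I_m) : injective f0 ->
  exists T, triangulation M T.
Proof.
move=> f0I; have [h [h0 hge0 ht]] := generic_heights f0I.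
exists (reg h); split.
- move=> J; rewrite inE => /existsP[f /andP[/andP[/injectiveP fI _] Jf]].
  exact: affinely_independent_sub fI Jf.
- move=> J J'; rewrite !inE => /existsP[f /andP[fh Jf]] J'J.
  by apply/existsP; exists f; rewrite fh (fintype.subset_trans J'J).
- by move=> J J'; exact: reg_inter.
- apply: (reg_cover f0I _ ht); apply/andP; split; first exact/injectiveP.
  (* The heights vanish on [f0], so its affine function is 0 and lies below the nonnegative
     heights. *)
  apply/forallP => k; rewrite /form (_ : colsub f0 h = 0) ?mul0mx ?mxE//.
  by apply/matrixP => a b; rewrite (ord1 a) !mxE.
Qed.
End Triangulation.

(** * Comparing the volume with the maximal minors *)

Lemma pigeonhole_fiber (I : finType) (N d : nat) (J : 'I_N -> I) :
  (#|I| * d < N)%N ->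
  exists (i : I) (g : 'I_(1 + d) -> 'I_N), injective g /\ forall k, J (g k) = i.
Proof.
move=> hN; have [i hi] : exists i, (1 + d <= #|[set k | J k == i]%SET|)%N.
  apply: contrapT => /forallNP h; move: hN; rewrite ltnNge => /negP; apply.
  rewrite -[X in (X <= _)%N]card_ord -sum1_card (partition_big J predT)//=.
  rewrite -sum_nat_const; apply: leq_sum => i _.
  have := h i; rewrite sum1_card cardsE => /negP; rewrite -ltnNge ltnS.
  exact: leq_trans (eq_leq (eq_card _)).
exists i, (fun k => enum_val (widen_ord hi k)); split.
  by move=> a b /enum_val_inj/(congr1 val)/= ab; exact: val_inj.
by move=> k; have := enum_valP (widen_ord hi k); rewrite inE => /eqP.
Qed.

Lemma det_le_entries (F : realFieldType) (n : nat) (W : 'M[F]_n) (s : F) :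
  (forall i j, `|W i j| <= s) -> `|\det W| <= n`!%:R * s ^+ n.
Proof.
move=> hW; apply: (le_trans (ler_norm_sum _ _ _)).
apply: (@le_trans _ _ (\sum_(p : 'S_n) s ^+ n)); last first.
  by rewrite sumr_const card_Sn mulr_natl.
apply: ler_sum => p _; rewrite normrM normrX normrN1 expr1n mul1r normr_prod.
rewrite -[in leRHS](card_ord n) -prodr_const; apply: ler_prod => i _.
by rewrite normr_ge0 hW.
Qed.

(* The points of a simplex with barycentric coordinates proportional to
   (1, k, ..., k ^ d) are in general position; if there are enough of them,
   one simplex of the cover contains d + 1. *)
Lemma simplex_le_cover (F : realFieldType) (d m : nat) (M : 'M[F]_(d, m))
    (T : {set {set 'I_m}}) (f : 'I_(1 + d) -> 'I_m) :
  (forall J, J \in T -> affinely_independent M J) ->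
  hull M [set: 'I_m]%SET `<=` \bigcup_(J in [set` T]) hull M J ->
  exists n : nat,
    `|\det (colsub f (bar_mx M))| <= n%:R * \sum_(J in T) abs_det M J.
Proof.
move=> Tind Tcov; set B := bar_mx M.
have [f0|fN0] := eqVneq (\det (colsub f B)) 0.
  by exists 0; rewrite f0 normr0 mul0r.
pose N := (#|{set 'I_m}| * d).+1.
pose S (k : 'I_N) : nat := (\sum_(i < 1 + d) k ^ i)%N.
have S0 k : (0 < S k)%N by rewrite /S big_ord_recl expn0.
pose u (k : 'I_N) : 'cV[F]_(1 + d) := \col_i (k ^ i)%:R.
have u0 k j : 0 <= spread f (u k) j 0.
  by rewrite mxE; apply: sumr_ge0 => i _; rewrite mxE ler0n.
(* Weights are left unnormalized, with total [S k] instead of 1: the coordinates with respect to [f]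
   stay natural numbers, and those with respect to the covering simplex are at most [S k]. *)
have hcov (k : 'I_N) : exists JW : {set 'I_m} * 'cV[F]_m,
    [/\ JW.1 \in T, forall j, j \notin JW.1 -> JW.2 j 0 = 0,
        forall j, `|JW.2 j 0| <= (S k)%:R & B *m JW.2 = colsub f B *m u k].
  pose s := (S k)%:R : F; have s0 : 0 < s by rewrite ltr0n S0.
  have sE : \sum_j spread f (u k) j 0 = s.
    under eq_bigr do rewrite mxE.
    rewrite (exchange_big_dep xpredT)//= /s /S natr_sum; apply: eq_bigr => i _.
    by rewrite (big_pred1 (f i)) ?mxE// => j; rewrite /= eq_sym.
  have [|J JT /hull_barP[w [w0 wJ wE]]] :=
      Tcov (\sum_j (s^-1 *: spread f (u k)) j 0 *: col j M).
    exists (fun j => (s^-1 *: spread f (u k)) j 0); split => //.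
    - by move=> j; rewrite mxE mulr_ge0// invr_ge0 ltW.
    - by move=> j; rewrite inE.
    - by under eq_bigr do rewrite mxE; rewrite -mulr_sumr sE mulVf ?gt_eqF.
  exists (J, s *: w) => /=; split => //.
  - by move=> j jJ; rewrite mxE wJ ?mulr0.
  - move=> j; rewrite mxE normrM (ger0_norm (w0 j)) (ger0_norm (ltW s0)).
    rewrite -/s ger_pMr//.
    move: wE; rewrite mul_bar_mx => /eq_col_mx[/matrixP/(_ 0 0)].
    rewrite !mxE => w1 _.
    by rewrite -w1 (bigD1 j)//= lerDl; apply: sumr_ge0 => i _; exact: w0.
  - rewrite -scalemxAr wE -mulmx_spread -/B [RHS]mul_bar_mx scale_col_mx.
    congr col_mx; first by rewrite sE; apply/matrixP => a b; rewrite !mxE mulr1.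
    rewrite scaler_sumr; apply: eq_bigr => j _.
    by rewrite scalerA [_ j 0]mxE mulVKf ?gt_eqF.
have /choice[JW JWP] := hcov.
have [J [g [gI gJ]]] := @pigeonhole_fiber _ N d (fun k => (JW k).1) (ltnSn _).
pose W : 'M[F]_(m, 1 + d) := \matrix_(i, j) (JW (g j)).2 i 0.
pose V : 'M[F]_(1 + d) := Vandermonde (1 + d) (\row_j (g j)%:R).
(* The same d + 1 points, written in the simplex [f] and in the simplex [J]. [V] is a Vandermonde
   matrix at distinct naturals, so its determinant is a product of nonzero integers. *)
have VE : colsub f B *m V = B *m W.
  apply/matrixP => a b; have [_ _ _ /matrixP/(_ a 0)] := JWP (g b).
  rewrite !mxE => E; transitivity (\sum_j B a j * (JW (g b)).2 j 0).
    rewrite E; apply: eq_bigr => i _; rewrite !mxE natrX.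
    by [].
  by apply: eq_bigr => i _; rewrite !mxE.
have V1 : 1 <= `|\det V|.
  rewrite det_Vandermonde normr_prod.
  elim/big_ind: _ => // [x y x1 y1|i _]; first exact: mulr_ege1.
  rewrite normr_prod; elim/big_ind: _ => // [x y x1 y1|j ij]; first exact: mulr_ege1.
  rewrite !mxE; have : (g j : nat) != g i.
    by apply/eqP => /val_inj/gI ji; move: ij; rewrite ji ltnn.
  rewrite neq_ltn => /orP[] h.
    by rewrite distrC ger0_norm ?subr_ge0 ?ler_nat 1?ltnW// lerBrDl
      -[1]/(1%:R) -natrD ler_nat addn1.
  by rewrite ger0_norm ?subr_ge0 ?ler_nat 1?ltnW// lerBrDl
    -[1]/(1%:R) -natrD ler_nat addn1.
have JT : J \in T by have [] := JWP (g 0); rewrite gJ.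
have WJ i j : i \notin J -> W i j = 0.
  by have [_ h _ _] := JWP (g j); rewrite gJ in h; rewrite mxE => /h.
have BWE (n : nat) (h : 'I_n -> 'I_m) : injective h ->
    (forall i, i \in J -> i \in codom h) ->
    B *m W = colsub h B *m rowsub h W.
  move=> hI hJ; apply/matrixP => a b; rewrite !mxE.
  rewrite (bigID (mem (codom h))) /= [X in _ + X]big1 ?addr0; last first.
    by move=> i ih; rewrite WJ ?mulr0//; apply: contra ih; exact: hJ.
  rewrite -big_uniq /=; last by apply/injectiveP.
  by rewrite big_map big_enum; apply: eq_bigr => i _; rewrite !mxE.
(* Affine independence bounds the size from above; from below, the invertible matrix
   [colsub f B *m V] factors through the columns in [J]. *)
have cJ : #|J| = (1 + d)%N.
  apply/eqP; rewrite eqn_leq; apply/andP; split.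
    by have <- := Tind _ JT; exact: rank_leq_row.
  have : \rank (colsub f B *m V) = (1 + d)%N.
    apply: mxrank_unit; rewrite unitmxE unitfE det_mulmx mulf_neq0//.
    by apply/eqP => V0; move: V1; rewrite V0 normr0 ler10.
  rewrite VE (BWE _ (@enum_val _ (mem J))); [|exact: enum_val_inj|]; last first.
    by move=> i iJ; apply/codomP; exists (enum_rank_in iJ i); rewrite enum_rankK_in.
  by move=> <-; apply: leq_trans (mxrankM_maxl _ _) (rank_leq_col _).
have [h hI hJ] := abs_det_enum M cJ.
pose s := (\sum_k S k)%N.
(* Leibniz bound for the minor of [W] on the rows in [J], whose entries are at most [s] because [s]
   dominates every [S k]. *)
exists ((1 + d)`! * s ^ (1 + d))%N.
rewrite (bigD1 J)//= mulrDr -[leLHS]addr0; apply: lerD; last first.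
  by rewrite mulr_ge0// sumr_ge0// => K _; exact: abs_det_ge0.
rewrite -hJ abs_det_imset// -/B.
apply: (@le_trans _ _ (`|\det (colsub f B)| * `|\det V|)).
  by rewrite ler_peMr.
rewrite -normrM -det_mulmx VE (BWE _ h)//; last first.
  by move=> i; rewrite -hJ => /imsetP[j _ ->]; exact: codom_f.
rewrite det_mulmx normrM mulrC ler_wpM2r// natrM natrX.
apply: det_le_entries => i j; rewrite !mxE.
have [_ _ /(_ (h i)) /le_trans -> //] := JWP (g j).
by rewrite ler_nat /s (bigD1 (g j))//= leq_addr.
Qed.

Lemma vol_ge0 (F : realFieldType) (d m : nat) (M : 'M[F]_(d, m)) : 0 <= vol M.
Proof.
by apply: sumr_ge0 => J _; rewrite mulr_ge0 ?invr_ge0 ?ler0n ?abs_det_ge0.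
Qed.

Lemma vol_le (F : realFieldType) (d m : nat) (M : 'M[F]_(d, m)) :
  vol M <= \sum_J abs_det M J.
Proof.
rewrite /vol big_mkcond; apply: ler_sum => J _.
case: ifP => _; last exact: abs_det_ge0.
by rewrite ler_piMl ?abs_det_ge0// invf_le1 ?ltr0n ?ler1n ?fact_gt0.
Qed.

(** Each minor is bounded through the triangulation that [xget] returns, which is a genuine one
    because some triangulation exists; a set of d + 1 columns, if there is one, supplies the
    starting simplex. *)
Lemma sum_abs_det_le_vol (F : realFieldType) (d m : nat) (M : 'M[F]_(d, m)) :
  general_position M ->
  exists n : nat, \sum_J abs_det M J <= n%:R * vol M.
Proof.
move=> gp.
suff /choice[c cP] (J : {set 'I_m}) : exists n : nat, abs_det M J <= n%:R * vol M.
  exists (\sum_J c J)%N; rewrite natr_sum mulr_suml.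
  by apply: ler_sum => J _; exact: cP.
have [cJ|cJ] := eqVneq #|J| (1 + d)%N; last first.
  by exists 0; rewrite mul0r abs_det_neq//; exact/eqP.
have [f fI <-] := abs_det_enum M cJ; rewrite abs_det_imset//.
have [T0 T0P] := triangulation_exists gp fI.
rewrite /vol; case: xgetP => [T TE TP|/(_ T0)//].
have [|n hn] := @simplex_le_cover F d m M T f (triang_simplex TP).
  by rewrite (triang_cover TP).
exists (n * d`!)%N; rewrite -mulr_sumr natrM mulrA mulfK//.
Qed.

(** * Coverings of parallelotopes by boxes *)

Lemma det_schur (F : fieldType) (n : nat) (a : F) (w : 'rV[F]_n) (v : 'cV[F]_n)
    (X : 'M[F]_n) : a != 0 ->
  \det (block_mx a%:M w v X) = a * \det (X - a^-1 *: (v *m w)).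
Proof.
move=> a0; pose U : 'M[F]_(1 + n) := block_mx 1%:M (- a^-1 *: w) 0 1%:M.
have UE : \det U = 1 by rewrite det_ublock !det1 mulr1.
rewrite -[LHS]mulr1 -UE -det_mulmx mulmx_block !mulmx0 !mulmx1 !addr0.
rewrite mul_scalar_mx scalerA mulrN mulfV// scaleN1r addNr det_lblock det_scalar1.
by rewrite -scalemxAr scaleNr addrC.
Qed.

(** Taking the largest entry of the first row as pivot keeps the elimination multipliers at most 1
    in absolute value, so the distortion depends on the dimension only. *)
Lemma row_pivot (F : realFieldType) (n : nat) (V : 'M[F]_(1 + n)) :
  exists s : 'S_(1 + n), forall j,
    `|col_perm s V 0 j| <= `|col_perm s V 0 0|.
Proof.
have [j _ jmax] := @arg_maxP _ _ _ (0 : 'I_(1 + n)) xpredT (fun j => `|V 0 j|) erefl.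
exists (tperm 0 j) => i; rewrite !mxE tpermL; exact: jmax.
Qed.

Lemma lshift00 n : lshift n 0 = 0 :> 'I_(1 + n).
Proof. exact: val_inj. Qed.

Lemma pivot_block_mx (F : nmodType) (n : nat) (V : 'M[F]_(1 + n)) :
  V = block_mx (V 0 0)%:M (ursubmx V) (dlsubmx V) (drsubmx V).
Proof.
rewrite -[LHS]submxK; congr block_mx; rewrite [LHS]mx11_scalar.
by rewrite !mxE lshift00.
Qed.

Section Parallelotope.
Variable R : realType.

Definition parallelotope (d : nat) (p : 'cV[R]_d) (V : 'M[R]_d) : set 'cV[R]_d :=
  [set x | exists2 t : 'cV[R]_d, forall i, `|t i 0| <= 1 & x = p + V *m t].

Lemma parallelotope_col_perm d p (V : 'M[R]_d) (s : 'S_d) :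
  parallelotope p (col_perm s V) = parallelotope p V.
Proof.
rewrite eqEsubset; split => x [t t1 ->].
  exists (row_perm s^-1 t); last by rewrite row_permE mulmxA -col_permE.
  by move=> i; rewrite mxE.
exists (row_perm s t); last first.
  by rewrite row_permE col_permE -mulmxA (mulmxA (perm_mx _)) -perm_mxM mulVg
    perm_mx1 mul1mx.
by move=> i; rewrite mxE.
Qed.

Lemma norm_det_col_perm d (V : 'M[R]_d) (s : 'S_d) :
  `|\det (col_perm s V)| = `|\det V|.
Proof.
by rewrite col_permE det_mulmx det_perm normrM normrX normrN1 expr1n mulr1.
Qed.

Section Pivot.
Variables (n : nat) (a : R) (w : 'rV[R]_n) (v : 'cV[R]_n) (X : 'M[R]_n).
Hypotheses (a0 : a != 0) (wa : forall j, `|w 0 j| <= `|a|).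
Let V1 := X - a^-1 *: (v *m w).

Let block_mulE (s : R) (t : 'cV[R]_n) :
  block_mx a%:M w v X *m col_mx (s%:M - a^-1 *: (w *m t)) t =
  col_mx (a * s)%:M (s *: v + V1 *m t).
Proof.
rewrite mul_block_col; congr col_mx.
  by rewrite mulmxBr -scalar_mxM mul_scalar_mx scalerA mulfV// scale1r subrK.
rewrite mulmxBr mul_mx_scalar -scalemxAr /V1 mulmxBl -scalemxAl mulmxA.
by rewrite -!addrA; congr (_ + _); rewrite addrC.
Qed.

Let norm_wt (t : 'cV[R]_n) (c : R) : 0 <= c -> (forall i, `|t i 0| <= c) ->
  `|(a^-1 *: (w *m t)) 0 0| <= n%:R * c.
Proof.
move=> c0 tc; rewrite mxE normrM normfV mulrC ler_pdivrMr ?normr_gt0// mxE.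
apply: (le_trans (ler_norm_sum _ _ _)).
apply: (@le_trans _ _ (\sum_(j < n) `|a| * c)).
  by apply: ler_sum => j _; rewrite normrM ler_pM.
by rewrite sumr_const card_ord -[leLHS]mulr_natl mulrA mulrAC.
Qed.

(** With [s] equal to the first coefficient plus [a^-1 *: (w *m t)], the slice orthogonal to the
    first axis at a given [s] is governed by the Schur complement [V1]. The correction is at most n
    times the bound on [t], so the bounds add up to (n + 1) / (n + 1) = 1. *)
Lemma parallelotope_pivot_sub p (s : R) (t : 'cV[R]_n) :
  `|s| <= (n.+1%:R)^-1 -> (forall i, `|t i 0| <= (n.+1%:R)^-1) ->
  parallelotope p (block_mx a%:M w v X)
    (p + col_mx (a * s)%:M (s *: v + V1 *m t)).
Proof.
move=> s1 t1; exists (col_mx (s%:M - a^-1 *: (w *m t)) t);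
  last by rewrite block_mulE.
have n0 : (0 : R) < n.+1%:R by rewrite ltr0n.
move=> i; case: (split_ordP i) => j ->; rewrite ?col_mxEu ?col_mxEd.
  rewrite (ord1 j) mxE [X in _ + X]mxE [s%:M _ _]mxE eqxx mulr1n.
  apply: (le_trans (ler_normB _ _)).
  apply: (le_trans (lerD s1 (norm_wt _ t1))); first by rewrite invr_ge0 ltW.
  by rewrite -[X in X + _]mul1r -mulrDl -natr1 addrC divff// natr1 gt_eqF.
by apply: (le_trans (t1 _)); rewrite invf_le1// ler1n.
Qed.

Lemma parallelotope_pivot_sup p x : parallelotope p (block_mx a%:M w v X) x ->
  exists s (t : 'cV[R]_n), [/\ `|s| <= n.+1%:R, forall i, `|t i 0| <= 1 &
    x = p + col_mx (a * s)%:M (s *: v + V1 *m t)].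
Proof.
move=> [t t1 ->]; rewrite -[t]vsubmxK.
set s := usubmx t; set t' := dsubmx t.
have t'1 i : `|t' i 0| <= 1 by rewrite mxE; exact: t1.
have s1 : `|s 0 0| <= 1 by rewrite mxE; exact: t1.
exists ((s + a^-1 *: (w *m t')) 0 0), t'; split => //.
  rewrite mxE; apply: (le_trans (ler_normD _ _)).
  by rewrite -nat1r lerD// -[leRHS]mulr1 norm_wt.
rewrite -block_mulE; congr (_ + _ *m col_mx _ _).
by rewrite -mx11_scalar addrK.
Qed.
End Pivot.

Lemma col_mx_scalar00 n (c : R) (y : 'cV[R]_n) : col_mx c%:M y 0 0 = c.
Proof.
by rewrite [X in col_mx _ _ X](_ : 0 = lshift n 0 :> 'I_(1 + n));
  [rewrite col_mxEu mxE eqxx mulr1n|exact: val_inj].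
Qed.

Lemma box_col_mx n (a b x : 'cV[R]_(1 + n)) :
  box a b x <-> a 0 0 <= x 0 0 <= b 0 0 /\ box (dsubmx a) (dsubmx b) (dsubmx x).
Proof.
split=> [h|[h0 h] i]; first by split=> [//|i]; rewrite !mxE.
case: (split_ordP i) => j ->; last by have := h j; rewrite !mxE.
by rewrite (ord1 j) (_ : lshift n ord0 = 0)//; exact: val_inj.
Qed.

Lemma box_vol_col_mx n (a b : 'cV[R]_(1 + n)) :
  box_vol a b = Num.max 0 (b 0 0 - a 0 0) * box_vol (dsubmx a) (dsubmx b).
Proof.
rewrite /box_vol big_split_ord/= big_ord1; congr (_ * _).
  by rewrite (_ : lshift n ord0 = 0)//; exact: val_inj.
by apply: eq_bigr => i _; rewrite !mxE.
Qed.

Lemma box_vol_ge0 d (a b : 'cV[R]_d) : 0 <= box_vol a b.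
Proof. by apply: prodr_ge0 => i _; rewrite le_max lexx. Qed.

(* Tonelli on the slices orthogonal to the first axis. *)
Lemma box_cover_slices n (l u c : R) (D : set nat) (a b : nat -> 'cV[R]_(1 + n)) :
  l <= u -> 0 <= c ->
  (forall x, l <= x <= u ->
    (c%:E <= \esum_(k in D `&` [set k | a k 0 0 <= x <= b k 0 0]%R)
      (box_vol (dsubmx (a k)) (dsubmx (b k)))%:E)%E) ->
  (((u - l) * c)%:E <= \esum_(k in D) (box_vol (a k) (b k))%:E)%E.
Proof.
move=> lu c0 h.
pose vol' k : R := if k \in D then box_vol (dsubmx (a k)) (dsubmx (b k)) else 0.
have vol'0 k : 0 <= vol' k by rewrite /vol'; case: ifP => // _; exact: box_vol_ge0.
pose f k (x : R) : \bar R := ((vol' k)%:E * (\1_(`[a k 0 0, b k 0 0]) x)%:E)%E.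
have f0 k x : (0 <= f k x)%E by rewrite mule_ge0 ?lee_fin.
have mf k (E : set R) : measurable_fun E (f k).
  apply: measurable_funeM; apply/measurable_EFinP; exact: measurable_indic.
have int_cst : (\int[lebesgue_measure]_(x in `[l, u]) (cst c%:E x) =
    ((u - l) * c)%:E)%E.
  rewrite integral_cst//= lebesgue_measure_itv/= lte_fin.
  case: ltgtP lu => // [lu _|-> _]; first by rewrite -EFinB -EFinM mulrC.
  by rewrite mule0 subrr mul0r.
rewrite -int_cst esum_mkcond -nneseries_esumT; last first.
  by move=> k; case: ifP => // _; rewrite lee_fin box_vol_ge0.
apply: (@le_trans _ _
  (\int[lebesgue_measure]_(x in `[l, u]) (\sum_(k <oo) f k x))%E).
  apply: ge0_le_integral => //.
  - by apply: (@ge0_emeasurable_sum _ _ R _ f xpredT).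
  move=> x; rewrite /= in_itv/= => /h /le_trans; apply.
  rewrite nneseries_esumT// esum_mkcond; apply: le_esum => k _.
  rewrite /f /vol' indicE in_setI.
  case: (k \in D) => /=; last by rewrite mul0e.
  rewrite (_ : (x \in _) = (k \in [set k | a k 0 0 <= x <= b k 0 0])); last first.
    by apply/idP/idP; rewrite !inE/= ?in_itv.
  by case: ifP => _; rewrite ?mule1 ?mule0.
rewrite integral_nneseries//; last by move=> k; exact: mf.
apply: lee_nneseries => [k _ _|k _] /=.
  by apply: integral_ge0 => x _.
rewrite ge0_integralZl_EFin//; last first.
  by apply/measurable_EFinP; exact: measurable_indic.
rewrite integral_indic//= /vol'.
case: ifP => _; last by rewrite mul0e.
rewrite box_vol_col_mx mulrC EFinM lee_pmul//; first by rewrite lee_fin box_vol_ge0.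
apply: (@le_trans _ _ (lebesgue_measure (`[a k 0 0, b k 0 0] : set R))).
  by apply: le_measure; rewrite ?inE//=; exact: measurableI.
rewrite lebesgue_measure_itv/= lte_fin -EFinB.
by case: ltP => ab; rewrite lee_fin le_max ?lexx ?orbT.
Qed.

Lemma box_cover_parallelotope (d : nat) : exists2 c : R, 0 < c &
  forall (V : 'M[R]_d) p (D : set nat) (a b : nat -> 'cV[R]_d),
  parallelotope p V `<=` \bigcup_(k in D) box (a k) (b k) ->
  ((c * `|\det V|)%:E <= \esum_(k in D) (box_vol (a k) (b k))%:E)%E.
Proof.
elim: d => [|n [c c0 IH]].
  (* In dimension 0 every box has volume 1, an empty product, and covering [p] takes at least one
     box. *)
  exists 1 => // V p D a b /(_ p) [].
    by exists 0; [case|rewrite mulmx0 addr0].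
  move=> k Dk _; rewrite det_mx00 normr1 mulr1.
  apply: esum_ge; exists [set k]; first by split=> // _ ->.
  by rewrite fsbig_set1 /box_vol big_ord0.
rewrite -[n.+1]/(1 + n)%N.
pose e : R := (n.+1%:R)^-1; have e0 : 0 < e by rewrite invr_gt0 ltr0n.
(* The factor [2 * e] comes from the range of [s] along the first axis, and [e ^+ n] from shrinking
   the slices by [e]. *)
exists (2 * e * (e ^+ n * c)); first by rewrite !mulr_gt0// exprn_gt0.
move=> V0 p D a b; have [s sP] := row_pivot V0.
rewrite -(parallelotope_col_perm _ _ s) -(norm_det_col_perm _ s).
move: (col_perm s V0) sP => {V0 s} V VP.
have sum0 : (0 <= \esum_(k in D) (box_vol (a k) (b k))%:E)%E.
  by apply: esum_ge0 => k _; rewrite lee_fin box_vol_ge0.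
have [V00|al0] := eqVneq (V 0 0) 0.
  rewrite (expand_det_row _ 0) big1 ?normr0 ?mulr0// => j _.
  by have := VP j; rewrite V00 normr0 normr_le0 => /eqP ->; rewrite mul0r.
pose w := ursubmx V; pose v := dlsubmx V; pose X := drsubmx V.
set al := V 0 0 in VP al0 *.
have VE : V = block_mx al%:M w v X by exact: pivot_block_mx.
have wal j : `|w 0 j| <= `|al|.
  rewrite mxE; apply: le_trans (VP (rshift 1 j)).
  by rewrite (_ : usubmx V 0 (rshift 1 j) = V 0 (rshift 1 j))// mxE lshift00.
rewrite VE det_schur//; set V1 := X - _ => cov.
have -> : 2 * e * (e ^+ n * c) * `|al * \det V1| =
    (p 0 0 + e * `|al| - (p 0 0 - e * `|al|)) * (c * `|\det (e *: V1)|).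
  by rewrite detZ !normrM normrX (gtr0_norm e0); ring.
apply: box_cover_slices.
- by rewrite lerD2l ge0_cp// mulr_ge0// ltW.
- by rewrite mulr_ge0// ltW.
move=> x xl; pose s := (x - p 0 0) / al.
have se : `|s| <= e.
  by rewrite normrM normfV ler_pdivrMr ?normr_gt0// ler_distl.
apply: (IH _ (dsubmx p + s *: v)) => _ [t t1 ->].
have [|k Dk /box_col_mx[h1 h2]] :=
    cov (p + col_mx (al * s)%:M (s *: v + V1 *m (e *: t))).
  apply: parallelotope_pivot_sub => // i.
  by rewrite mxE normrM gtr0_norm// ger_pMr.
move: h1 h2; rewrite [dsubmx (_ + _)]linearD/= col_mxKd => h1 h2.
exists k; last by rewrite -scalemxAl scalemxAr -addrA.
split => //=; move: h1; rewrite mxE [X in _ + X](_ : _ = al * s).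
  by rewrite /s mulrC divfK// addrC subrK.
by rewrite col_mx_scalar00.
Qed.

(** The total volume after lengthening all sides by 2x is bounded by a polynomial in x, continuous
    at 0. It is only a bound since a negative side counts as 0 before it is lengthened. *)
Lemma thicken_boxes d (s : seq ('cV[R]_d * 'cV[R]_d)) (e : R) : 0 < e ->
  exists2 h : R, 0 < h &
    \sum_(ab <- s) box_vol (ab.1 - const_mx h) (ab.2 + const_mx h) <=
    \sum_(ab <- s) box_vol ab.1 ab.2 + e.
Proof.
move=> e0.
pose p : {poly R} := \sum_(ab <- s) \prod_i
  ((Num.max 0 (ab.2 i 0 - ab.1 i 0))%:P + 2 *: 'X).
have pE x : p.[x] = \sum_(ab <- s) \prod_i
    (Num.max 0 (ab.2 i 0 - ab.1 i 0) + 2 * x).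
  rewrite horner_sum; apply: eq_bigr => ab _; rewrite horner_prod.
  by apply: eq_bigr => i _; rewrite hornerD hornerC hornerZ hornerX.
have p0 : p.[0] = \sum_(ab <- s) box_vol ab.1 ab.2.
  rewrite pE; apply: eq_bigr => ab _; apply: eq_bigr => i _.
  by rewrite mulr0 addr0.
have /cvgrPdist_lt/(_ e e0)/nbhs_ballP[r /= r0 hr] := @continuous_horner _ p 0.
exists (r / 2); first by rewrite divr_gt0.
apply: (@le_trans _ _ p.[r / 2]).
  rewrite pE; apply: ler_sum => ab _; apply: ler_prod => i _.
  rewrite le_max lexx /= !mxE ge_max; have := divr_gt0 r0 (ltr0n _ 2 : 0 < 2 :> R).
  have : Num.max 0 (ab.2 i 0 - ab.1 i 0) >= 0 by rewrite le_max lexx.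
  have : Num.max 0 (ab.2 i 0 - ab.1 i 0) >= ab.2 i 0 - ab.1 i 0.
    by rewrite le_max lexx orbT.
  by move=> h1 h2 h3; apply/andP; split; lra.
have /hr : ball (0 : R) r (r / 2).
  rewrite /ball/= sub0r normrN gtr0_norm ?divr_gt0//.
  by rewrite ltr_pdivrMr// ltr_pMr// ltr1n.
by rewrite /= p0 ltr_norml => /andP[h _]; lra.
Qed.

Lemma nat_slice (N : nat) (x : R) : 0 <= x <= N.+1%:R ->
  exists2 l : nat, (l < N.+1)%N & l%:R <= x <= l.+1%:R.
Proof.
elim: N => [|N IH] /andP[x0 xN]; first by exists 0 => //; rewrite x0.
have [xl|xl] := leP x N.+1%:R; last by exists N.+1 => //; rewrite ltW.
by have [|l lN lx] := IH; [rewrite x0|exists l => //; exact: ltnW].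
Qed.

Lemma parallelotope_cover (d : nat) : exists2 C : R, 0 < C &
  forall (V : 'M[R]_d) p (e : R), 0 < e ->
  exists2 s : seq ('cV[R]_d * 'cV[R]_d),
    (forall x, parallelotope p V x -> exists2 ab, ab \in s & box ab.1 ab.2 x) &
    \sum_(ab <- s) box_vol ab.1 ab.2 <= C * `|\det V| + e.
Proof.
elim: d => [|n [C C0 IH]].
  exists 1 => // V p e e0; exists [:: (0, 0)].
    by move=> x _; exists (0, 0); rewrite ?inE//; case.
  by rewrite big_seq1 /box_vol big_ord0 det_mx00 normr1 mulr1 lerDl ltW.
rewrite -[n.+1]/(1 + n)%N.
have L0 : (0 : R) < n.+1%:R by rewrite ltr0n.
(* The range of [s] has length [2 * n.+1%:R]; another factor 2 arises because each slab reaches [dl]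
   to both sides of its base point. *)
exists (4 * n.+1%:R * C); first by rewrite !mulr_gt0.
move=> V0 p e e0; have [s sP] := row_pivot V0.
rewrite -(parallelotope_col_perm _ _ s) -(norm_det_col_perm _ s).
move: (col_perm s V0) sP => {V0 s} V VP.
have [V00|al0] := eqVneq (V 0 0) 0.
  have V0j j : V 0 j = 0.
    by have := VP j; rewrite V00 normr0 normr_le0 => /eqP.
  (* The first row vanishes, so the parallelotope lies in a hyperplane orthogonal to the first axis
     and fits in one box with a side of length 0. *)
  pose r : 'cV[R]_(1 + n) := \col_i \sum_j `|V i j|.
  have rP (t : 'cV[R]_(1 + n)) i : (forall i, `|t i 0| <= 1) ->
      `|(V *m t) i 0| <= r i 0.
    move=> t1; rewrite !mxE; apply: (le_trans (ler_norm_sum _ _ _)).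
    by apply: ler_sum => j _; rewrite normrM ler_piMr.
  exists [:: (p - r, p + r)].
    move=> x [t /rP t1 ->]; exists (p - r, p + r); rewrite ?inE// => i /=.
    have := t1 i; move: (V *m t) => q; rewrite !mxE ler_norml lerD2l.
    by rewrite lerD2l.
  rewrite big_seq1 /= box_vol_col_mx !mxE big1 ?subr0 ?addr0 ?subrr ?maxxx ?mul0r.
    by rewrite addr_ge0 ?(ltW e0)// mulr_ge0// ltW// !mulr_gt0.
  by move=> j _; rewrite V0j normr0.
pose w := ursubmx V; pose v := dlsubmx V; pose X := drsubmx V.
set al := V 0 0 in VP al0 *.
have VE : V = block_mx al%:M w v X by exact: pivot_block_mx.
have wal j : `|w 0 j| <= `|al|.
  rewrite mxE; apply: le_trans (VP (rshift 1 j)).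
  by rewrite (_ : usubmx V 0 (rshift 1 j) = V 0 (rshift 1 j))// mxE lshift00.
rewrite VE det_schur//; set V1 := X - _.
have a0 : 0 < `|al| by rewrite normr_gt0.
pose K := 4 * n.+1%:R * `|al|; have K0 : 0 < K by rewrite !mulr_gt0.
(* The slack [e'] is spent twice, on the cover of the slice and on its thickening, and both are
   multiplied by [K], the total width of the slabs. *)
pose e' := e / (2 * K); have e'0 : 0 < e' by rewrite divr_gt0// mulr_gt0.
have [s' s'cov s'vol] := IH V1 (dsubmx p) e' e'0.
have [h h0 hvol] := thicken_boxes s' e'0.
(* The number of slabs is chosen after [h]: within one slab the slice moves along [v] by at most
   [h]. *)
have [N hN] : exists N : nat, forall i, `|v i 0| * (2 * n.+1%:R / N.+1%:R) <= h.
  pose B := (\sum_i `|v i 0|) * (2 * n.+1%:R) / h.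
  exists (Num.bound B) => i.
  rewrite mulrA ler_pdivrMr ?ltr0n//.
  apply: (@le_trans _ _ (h * B)).
    rewrite [h * B]mulrC /B divfK ?gt_eqF// ler_wpM2r ?mulr_ge0//.
    by rewrite (bigD1 i)//= lerDl sumr_ge0.
  apply: ler_wpM2l; first exact: ltW.
  apply: (@le_trans _ _ (Num.bound B)%:R); last by rewrite ler_nat.
  rewrite ltW// archi_boundP// divr_ge0 ?(ltW h0)//.
  by rewrite !mulr_ge0// sumr_ge0.
(* Slice along the first axis; in each slice translate the boxes of [s'],
   thickened by [h] to absorb the shear. *)
pose dl : R := 2 * n.+1%:R / N.+1%:R.
have dl0 : 0 < dl by rewrite divr_gt0// mulr_gt0.
pose sl (l : nat) : R := dl * l%:R - n.+1%:R.
pose bx (l : nat) (ab : 'cV[R]_n * 'cV[R]_n) : 'cV[R]_(1 + n) * 'cV[R]_(1 + n) :=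
  (col_mx (p 0 0 + al * sl l - `|al| * dl)%:M (ab.1 - const_mx h + sl l *: v),
   col_mx (p 0 0 + al * sl l + `|al| * dl)%:M (ab.2 + const_mx h + sl l *: v)).
exists [seq bx l ab | l <- iota 0 N.+1, ab <- s'].
  move=> x /parallelotope_pivot_sup[]// sx [t [sx1 t1 ->]].
  have [|l lN lx] := @nat_slice N ((sx + n.+1%:R) / dl).
    move: sx1; rewrite ler_norml => /andP[sx1 sx2].
    rewrite divr_ge0 ?(ltW dl0)//=; last by lra.
    rewrite ler_pdivrMr// /dl mulrCA divff ?mulr1 ?pnatr_eq0//; lra.
  have {lx}lx : `|sx - sl l| <= dl.
    move: lx; rewrite ler_pdivlMr// ler_pdivrMr// -[l.+1%:R]natr1 mulrDl.
    rewrite mul1r ler_norml.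
    by rewrite /sl [dl * _]mulrC => /andP[h1 h2]; apply/andP; split; lra.
  have [ab abs' abx] := s'cov (dsubmx p + V1 *m t) (ex_intro2 _ _ t t1 erefl).
  exists (bx l ab).
    by apply/allpairsP; exists (l, ab); rewrite mem_iota.
  apply/box_col_mx; rewrite /bx /= !col_mxKd [dsubmx (_ + _)]linearD/= col_mxKd.
  split.
    rewrite [(p + _) 0 0]mxE !col_mx_scalar00.
    have := ler_wpM2l (normr_ge0 al) lx; rewrite -normrM mulrBr ler_norml.
    by move=> /andP[h1 h2]; apply/andP; split; lra.
  move=> i; have := abx i; have : `|(sx - sl l) * v i 0| <= h.
    by apply: le_trans (hN i); rewrite normrM mulrC ler_wpM2l.
  move: (V1 *m t) => q; rewrite !mxE mulrBl ler_norml => /andP[h3 h4] /andP[h1 h2].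
  by apply/andP; split; lra.
rewrite big_allpairs_dep.
under eq_bigr => l _.
  have E ab : box_vol (bx l ab).1 (bx l ab).2 =
      2 * `|al| * dl * box_vol (ab.1 - const_mx h) (ab.2 + const_mx h).
    rewrite box_vol_col_mx !col_mxKd; congr (_ * _).
      rewrite !col_mx_scalar00 max_r; first by ring.
      by have := mulr_gt0 a0 dl0; lra.
    by apply: eq_bigr => i _; rewrite !mxE; congr (Num.max _ _); ring.
  under eq_bigr do rewrite E.
  rewrite -mulr_sumr; over.
rewrite big_const_seq count_predT size_iota iter_addr_0 -[leLHS]mulr_natl.
rewrite mulrA (_ : N.+1%:R * _ = K); last first.
  rewrite /K /dl; field.
  by rewrite addrC natr1 pnatr_eq0.
apply: (@le_trans _ _ (K * (C * `|\det V1| + e' + e'))).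
  by apply: ler_wpM2l; [exact: ltW|apply: (le_trans hvol); rewrite lerD2r].
rewrite normrM le_eqVlt; apply/orP; left; apply/eqP.
rewrite /e' /K; field.
by rewrite gt_eqF//= normr_eq0 al0 addrC natr1 pnatr_eq0.
Qed.

End Parallelotope.

(** * Euclidean volume of a polytope *)

Section EuclideanVolume.
Variable R : realType.

Lemma euclidean_vol_le_boxes d (s : seq ('cV[R]_d * 'cV[R]_d)) (X : set 'cV[R]_d) :
  (forall x, X x -> exists2 ab, ab \in s & box ab.1 ab.2 x) ->
  (euclidean_vol X <= (\sum_(ab <- s) box_vol ab.1 ab.2)%:E)%E.
Proof.
move=> h; apply: ge_ereal_inf; pose F k := nth (0, 0) s k.
exists (\esum_(k in `I_(size s)) (box_vol (F k).1 (F k).2)%:E)%E; last first.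
  rewrite esum_fset//; last by move=> k _; rewrite lee_fin box_vol_ge0.
  rewrite -fsbig_ord sumEFin lee_fin (big_nth (0, 0)) big_mkord.
  by [].
exists `I_(size s), (fun k => (F k).1), (fun k => (F k).2); split => //.
move=> x /h[ab abs abx]; exists (index ab s); first by rewrite /= index_mem.
by rewrite /F nth_index.
Qed.

Lemma euclidean_vol_sub_parallelotope (d : nat) : exists2 C : R, 0 < C &
  forall (X : set 'cV[R]_d) p (V : 'M[R]_d), X `<=` parallelotope p V ->
    (euclidean_vol X <= (C * `|\det V|)%:E)%E.
Proof.
have [C C0 h] := parallelotope_cover R d; exists C => // X p V XV.
apply/lee_addgt0Pr => e e0; have [s sP sC] := h V p e e0.
apply: (@le_trans _ _ (\sum_(ab <- s) box_vol ab.1 ab.2)%:E).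
  by apply: euclidean_vol_le_boxes => x /XV/sP.
by rewrite -EFinD lee_fin.
Qed.

Lemma euclidean_vol_sup_parallelotope (d : nat) : exists2 c : R, 0 < c &
  forall (X : set 'cV[R]_d) p (V : 'M[R]_d), parallelotope p V `<=` X ->
    ((c * `|\det V|)%:E <= euclidean_vol X)%E.
Proof.
have [c c0 h] := box_cover_parallelotope R d; exists c => // X p V VX.
apply/ereal_infP => _ [D [a [b [cov ->]]]].
by apply: h => x /VX/cov.
Qed.

Lemma euclidean_vol_hull_ge (d m : nat) : exists2 c : R, 0 < c &
  forall M : 'M[R]_(d, m),
    ((c * \sum_J abs_det M J)%:E <= euclidean_vol (hull M [set: 'I_m]%SET))%E.
Proof.
have [c c0 h] := euclidean_vol_sup_parallelotope d.
(* Edge coordinates in [[0, 2 * e]] add up to at most [2 * e * d <= 1], so a parallelotope of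
   half-width [e] around the point with all edge coordinates [e] stays inside the simplex. *)
pose e : R := (2 * (1 + d)%:R)^-1.
have e0 : 0 < e by rewrite invr_gt0 mulr_gt0// ltr0n.
pose N : R := #|{: {set 'I_m}}|%:R.
have N0 : 0 < N by rewrite ltr0n; apply/card_gt0P; exists finset.set0.
exists (c * e ^+ d / N) => [|M]; first by rewrite divr_gt0// mulr_gt0// exprn_gt0.
have [J _ Jmax] := @arg_maxP _ _ _ finset.set0 xpredT (abs_det M) erefl.
apply: (@le_trans _ _ (c * (e ^+ d * abs_det M J))%:E).
  rewrite lee_fin (_ : c * (_ * _) = c * e ^+ d / N * (abs_det M J * N)); last first.
    by rewrite mulrA [abs_det M J * N]mulrC mulrA divfK ?gt_eqF.
  apply: ler_wpM2l.
    by rewrite ltW// divr_gt0// mulr_gt0// exprn_gt0.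
  apply: (@le_trans _ _ (\sum_(K : {set 'I_m}) abs_det M J)).
    by apply: ler_sum => K _; exact: Jmax.
  by rewrite sumr_const mulr_natr.
have [cJ|/eqP cJ] := eqVneq #|J| (1 + d)%N; last first.
  rewrite abs_det_neq// !mulr0; apply/ereal_infP => _ [D [a [b [_ ->]]]].
  by apply: esum_ge0 => k _; rewrite lee_fin box_vol_ge0.
have [f fI <-] := abs_det_enum M cJ; rewrite abs_det_imset// det_bar_mx.
have -> : e ^+ d * `|\det (edge_mx M f)| = `|\det (e *: edge_mx M f)|.
  by rewrite detZ normrM normrX (gtr0_norm e0).
apply: (h _ (col (f ord0) M + edge_mx M f *m const_mx e)).
move=> _ [t t1 ->].
pose u : 'cV[R]_d := const_mx e + e *: t.
have u0 i : 0 <= u i 0.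
  by have := t1 i; rewrite !mxE ler_norml => /andP[h1 h2]; nra.
have u2 i : u i 0 <= e * 2.
  by have := t1 i; rewrite !mxE ler_norml => /andP[h1 h2]; nra.
apply/hull_barP; exists (spread f (col_mx (1%:M - const_mx 1 *m u) u)); split.
- move=> j; rewrite mxE sumr_ge0// => i _.
  case: (split_ordP i) => k ->; rewrite ?col_mxEu ?col_mxEd//.
  rewrite (ord1 k) !mxE eqxx mulr1n subr_ge0.
  apply: (@le_trans _ _ (\sum_(i < d) e * 2)).
    by apply: ler_sum => l _; rewrite [const_mx _ _ _]mxE mul1r.
  rewrite sumr_const card_ord -[leLHS]mulr_natr -mulrA mulrC.
  rewrite ler_pdivrMr ?mulr_gt0 ?ltr0n// mul1r ler_pM2l//.
  by rewrite ler_nat leq_addl.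
- by move=> j; rewrite inE.
by rewrite mulmx_spread mul_colsub_bar_mx -addrA -scalemxAl scalemxAr -mulmxDr.
Qed.

(** The disjunction lists the cases met in general position, where the minors can all vanish only if
    there are too few columns. *)
Lemma euclidean_vol_hull_le (d m : nat) : exists2 C : R, 0 < C &
  forall M : 'M[R]_(d, m), (\sum_J abs_det M J != 0) || (m < 1 + d)%N ->
    (euclidean_vol (hull M [set: 'I_m]%SET) <= (C * \sum_J abs_det M J)%:E)%E.
Proof.
have [C C0 h] := euclidean_vol_sub_parallelotope d; exists C => // M.
have [Jm _ Jmax] := @arg_maxP _ _ _ finset.set0 xpredT (abs_det M) erefl.
have S0 : 0 <= \sum_J abs_det M J by apply: sumr_ge0 => J _; exact: abs_det_ge0.
case/orP => [SN0|md].
  have Jm0 : abs_det M Jm != 0.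
    apply: contra SN0 => /eqP J0; rewrite eq_le S0 andbT.
    by apply: sumr_le0 => J _; have := Jmax J erefl; rewrite J0.
  have cJ : #|Jm| = (1 + d)%N.
    by apply: contrapT => /(abs_det_neq M) J0; rewrite J0 eqxx in Jm0.
  have [f fI fJ] := abs_det_enum M cJ.
  have fdet : abs_det M Jm = `|\det (colsub f (bar_mx M))|.
    by rewrite -fJ abs_det_imset.
  have fU : colsub f (bar_mx M) \in unitmx.
    by rewrite unitmxE unitfE; apply: contra Jm0 => /eqP f0; rewrite fdet f0 normr0.
  apply: (@le_trans _ _ (C * `|\det (edge_mx M f)|)%:E); last first.
    rewrite lee_fin; apply: ler_wpM2l; first exact: ltW.
    rewrite -det_bar_mx -fdet (bigD1 Jm)//= lerDl.
    by apply: sumr_ge0 => J _; exact: abs_det_ge0.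
  apply: (h _ (col (f ord0) M)) => x /hull_barP[w [w0 _ wE]].
  pose l := invmx (colsub f (bar_mx M)) *m bar_mx M.
  (* An exchange multiplies the minor by [l i k], and the minor of [f] is already the largest. *)
  have l1 i k : `|l i k| <= 1.
    have [/codomP[j ->]|kf] := boolP (k \in codom f).
      by rewrite /l mulVmx_colsub//; case: eqP; rewrite ?normr1 ?normr0.
    have gI : injective (fupd f i k).
      by apply: fupd_inj => // j; apply: contra kf => /eqP <-; exact: codom_f.
    have := Jmax _ (erefl true) :
      abs_det M [set fupd f i k j | j : 'I_(1 + d)]%SET <= _.
    rewrite abs_det_imset// cramer_fupd// fdet normrM.
    by rewrite ger_pMl// -fdet lt_neqAle eq_sym Jm0 abs_det_ge0.
  have w1 : \sum_j w j 0 = 1.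
    by move: wE; rewrite mul_bar_mx => /eq_col_mx[/matrixP/(_ 0 0)]; rewrite !mxE.
  have lw1 i : `|(l *m w) i 0| <= 1.
    rewrite mxE -[leRHS]w1; apply: (le_trans (ler_norm_sum _ _ _)).
    by apply: ler_sum => k _; rewrite normrM [`|w k 0|]ger0_norm// ler_piMl.
  exists (dsubmx (l *m w)); first by move=> i; rewrite mxE.
  have E : colsub f (bar_mx M) *m (l *m w) = col_mx (const_mx 1) x.
    by rewrite /l -mulmxA mulKVmx.
  have uE : usubmx (l *m w) = 1%:M - const_mx 1 *m dsubmx (l *m w).
    move: E; rewrite -{1}[l *m w]vsubmxK colsub_bar_mx mul_block_col.
    move=> /eq_col_mx[+ _]; rewrite mul1mx => /(canRL (addrK _)) ->.
    by congr (_ - _); apply/matrixP => a b; rewrite !mxE !ord1.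
  move: E; rewrite -{1}[l *m w]vsubmxK uE mul_colsub_bar_mx.
  by move=> /eq_col_mx[_ <-].
apply: (@le_trans _ _ 0%E); last by rewrite lee_fin mulr_ge0// ltW.
(* Without columns the hull is empty, and the empty cover gives volume 0. *)
case: m M md {Jm Jmax S0} => [|m] M md.
  have := @euclidean_vol_le_boxes d [::] (hull M [set: 'I_0]%SET).
  rewrite big_nil; apply => x [w [_ _ + _]].
  by rewrite big_ord0 => /esym/eqP; rewrite oner_eq0.
rewrite -[m.+1]/(1 + m)%N in M md *.
(* The fewer than d edges are padded with zero columns to a square matrix, which is singular. *)
pose V : 'M[R]_d := edge_mx M id *m pid_mx m.
have V0 : \det V = 0.
  apply/eqP; rewrite -[_ == _]negbK -unitfE -unitmxE -row_free_unit.
  rewrite /row_free neq_ltn; apply/orP; left.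
  apply: (leq_ltn_trans (mxrankM_maxl _ _)); apply: (leq_ltn_trans (rank_leq_col _)).
  exact: md.
have -> : 0%E = (C * `|\det V|)%:E by rewrite V0 normr0 mulr0.
apply: (h _ (col ord0 M)) => x /hull_barP[w [w0 _ wE]].
have w1 : \sum_j w j 0 = 1.
  by move: wE; rewrite mul_bar_mx => /eq_col_mx[/matrixP/(_ 0 0)]; rewrite !mxE.
exists (pid_mx m *m dsubmx w).
  move=> i; rewrite mxE -[leRHS]w1 big_split_ord /= big_ord1 -[leLHS]add0r lerD//.
  apply: (le_trans (ler_norm_sum _ _ _)); apply: ler_sum => k _.
  rewrite !mxE normrM [`|w _ 0|]ger0_norm// ler_piMl//.
  by case: (_ && _); rewrite ?normr1 ?normr0.
rewrite /V mulmxA -[edge_mx M id *m _ *m _]mulmxA mul_pid_mx.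
have -> : minn d (minn m m) = m by rewrite minnn; apply/minn_idPr; exact: ltnW md.
rewrite pid_mx_1 mulmx1.
have wu : w = col_mx (1%:M - const_mx 1 *m dsubmx w) (dsubmx w).
  rewrite -[LHS]vsubmxK; congr col_mx.
  apply/matrixP => a b; rewrite !mxE !ord1 eqxx mulr1n.
  under eq_bigr do rewrite !mxE mul1r.
  apply: (canRL (addrK _)).
  by rewrite -w1 [RHS]big_split_ord /= big_ord1.
have cid : colsub id (bar_mx M) = bar_mx M by apply/matrixP => a b; rewrite mxE.
move: wE; rewrite {1}wu -{1}cid.
by rewrite mul_colsub_bar_mx => /eq_col_mx[_ <-].
Qed.
End EuclideanVolume.

(** * Valuations *)

Lemma ereal_between (R : realType) (x y : \bar R) : (x < y)%E ->
  exists2 s : R, (x < s%:E)%E & (s%:E < y)%E.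
Proof.
case: x y => [x| |] [y| |] //= xy.
- rewrite lte_fin in xy; exists ((x + y) / 2); rewrite lte_fin; lra.
- by exists (x + 1); rewrite ?ltry// lte_fin; lra.
- by exists (y - 1); rewrite ?ltNyr// lte_fin; lra.
- by exists 0; rewrite ?ltry ?ltNyr.
Qed.

Lemma powR_eventually_ge (R : realType) (e c : R) : 0 < e ->
  \forall t \near +oo, c <= t `^ e.
Proof.
move=> e0; near=> t; apply: (le_trans (ler_norm _)).
rewrite -[leLHS]powRr1// -[X in _ `^ X](mulVf (lt0r_neq0 e0)) powRrM.
have ct : `|c| `^ e^-1 <= t by near: t; exact: nbhs_pinfty_ge.
apply: ge0_ler_powR; rewrite ?nnegrE ?powR_ge0// ?(ltW e0)//.
Unshelve. all: by end_near. Qed.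

(** The logarithmic limit, phrased by comparison with powers of t. Strict inequalities treat
    infinite [v] uniformly and leave a gap between exponents in which constant factors disappear. *)
Definition growth (R : realType) (y : R -> \bar R) (v : \bar R) :=
  (forall r : R, (r%:E < v)%E -> \forall t \near +oo, ((t `^ r)%:E <= y t)%E) /\
  (forall r : R, (v < r%:E)%E -> \forall t \near +oo, (y t <= (t `^ r)%:E)%E).

Lemma log_ratio_powR (R : realType) (r t : R) : 1 < t ->
  log_ratio (t `^ r)%:E t = r%:E.
Proof.
move=> t1; have t0 : 0 < t by apply: lt_trans t1.
rewrite /log_ratio lne_EFin ?powR_gt0// ln_powR -EFinM mulfK//.
by rewrite gt_eqF// ln_gt0.
Qed.

Lemma le_log_ratio (R : realType) (x y : \bar R) (t : R) : 1 < t ->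
  (0 <= x)%E -> (x <= y)%E -> (log_ratio x t <= log_ratio y t)%E.
Proof.
move=> t1 x0 xy; apply: lee_wpmul2r; first by rewrite lee_fin invr_ge0 ln_ge0// ltW.
have z0 (z : \bar R) : (0 <= z)%E -> z \in `[0%E, +oo%E].
  by move=> z0; rewrite in_itv/= z0 leey.
by rewrite lee_lne// z0// (le_trans x0).
Qed.

Lemma growth_cvg (R : realType) (y : R -> \bar R) (v : \bar R) :
  (forall t, 0 <= y t)%E -> growth y v ->
  log_ratio (y t) t @[t --> +oo] --> v.
Proof.
move=> y0 [ylo yhi].
have lo r : (r%:E < v)%E -> \forall t \near +oo, (r%:E <= log_ratio (y t) t)%E.
  move=> /ylo; apply: filter_app; near=> t.
  have t1 : 1 < t by near: t; exact: nbhs_pinfty_gt.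
  move=> /(le_log_ratio t1); rewrite log_ratio_powR//; apply.
  by rewrite lee_fin powR_ge0.
have hi r : (v < r%:E)%E -> \forall t \near +oo, (log_ratio (y t) t <= r%:E)%E.
  move=> /yhi; apply: filter_app; near=> t.
  have t1 : 1 < t by near: t; exact: nbhs_pinfty_gt.
  by move=> /(le_log_ratio t1); rewrite log_ratio_powR//; apply.
case: v lo hi {ylo yhi} => [v| |] lo hi.
- have bnd e : 0 < e -> \forall t \near +oo,
      ((v - e)%:E <= log_ratio (y t) t <= (v + e)%:E)%E.
    move=> e0; have h1 : ((v - e)%:E < v%:E)%E by rewrite lte_fin; lra.
    have h2 : (v%:E < (v + e)%:E)%E by rewrite lte_fin; lra.
    by near=> t; apply/andP; split; near: t; [exact: lo|exact: hi].
  apply/fine_cvgP; split.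
    have := bnd 1 ltr01; apply: filter_app; near=> t => /andP[].
    by case: (log_ratio _ _).
  apply/cvgrPdist_le => e e0; have := bnd e e0; apply: filter_app; near=> t.
  rewrite /comp; case: (log_ratio _ _) => [z| |] /andP[]//=.
  by rewrite !lee_fin => h1 h2; rewrite distrC ler_distl h1 h2.
- by apply/cvgeyPge => r; apply: lo; rewrite ltry.
- by apply/cvgeNyPle => r; apply: hi; rewrite ltNyr.
Unshelve. all: by end_near. Qed.

Section Valuation.
Variables (R : realType) (S : set_structure R) (K : hardy_field S).
Implicit Types (f g : K) (u v : \bar R).

Lemma germ_zero : \forall t \near +oo, germ_fun (0 : K) t = 0.
Proof.
have := germ_add (0 : K) 0; apply: filter_app; near=> t.
by rewrite addr0 => /eqP; rewrite -[eqbLHS]addr0 (inj_eq (addrI _)) eq_sym => /eqP.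
Unshelve. all: by end_near. Qed.

Lemma germ_opp f : \forall t \near +oo, germ_fun (- f) t = - germ_fun f t.
Proof.
have := germ_add f (- f); apply: filter_app; have := germ_zero.
apply: filter_app; near=> t; rewrite subrr => -> /esym/eqP.
by rewrite addrC addr_eq0 => /eqP.
Unshelve. all: by end_near. Qed.

Lemma germ_norm f : \forall t \near +oo, germ_fun `|f| t = `|germ_fun f t|.
Proof.
have [f0|f0] := leP 0 f.
  have /germ_le := f0; apply: filter_app; have := germ_zero.
  by apply: filter_app; near=> t => -> f0t; rewrite !ger0_norm.
have /germ_le := ltW f0; apply: filter_app; have := germ_zero.
apply: filter_app; have := germ_opp f; apply: filter_app.
by near=> t => ft -> f0t; rewrite ltr0_norm// ft ler0_norm.
Unshelve. all: by end_near. Qed.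

Lemma germ_eq f g :
  (\forall t \near +oo, germ_fun f t = germ_fun g t) -> f = g.
Proof.
move=> fg; apply/eqP; rewrite eq_le; apply/andP; split; apply/germ_le;
  by apply: filterS fg => t ->.
Qed.

Definition germ_pow (r : R) : K := projT1 (cid (germ_power K r)).

Lemma germ_powP r : \forall t \near +oo, germ_fun (germ_pow r) t = t `^ r.
Proof. exact: projT2 (cid (germ_power K r)). Qed.

Lemma germ_pow_gt0 r : 0 < germ_pow r.
Proof.
rewrite lt_neqAle; apply/andP; split; last first.
  apply/germ_le; have := germ_zero; apply: filter_app.
  have := germ_powP r; apply: filter_app; near=> t => -> ->.
  exact: powR_ge0.
apply/eqP => E; suff h : \forall t \near (+oo : set_system R), (fun=> False) t.
  by have [t] := filter_ex h.
near=> t; have t0 : 0 < t by near: t; exact: nbhs_pinfty_gt.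
have : germ_fun (germ_pow r) t = t `^ r by near: t; exact: germ_powP.
rewrite -E (near germ_zero t)//.
by move=> /eqP; rewrite eq_sym gt_eqF// powR_gt0.
Unshelve. all: by end_near. Qed.

Lemma germ_powD r s : germ_pow (r + s) = germ_pow r * germ_pow s.
Proof.
apply: germ_eq; near=> t; have t0 : 0 < t by near: t; exact: nbhs_pinfty_gt.
have -> : germ_fun (germ_pow (r + s)) t = t `^ (r + s).
  by near: t; exact: germ_powP.
have -> : germ_fun (germ_pow r * germ_pow s) t =
    germ_fun (germ_pow r) t * germ_fun (germ_pow s) t.
  by near: t; exact: germ_mul.
have -> : germ_fun (germ_pow r) t = t `^ r by near: t; exact: germ_powP.
have -> : germ_fun (germ_pow s) t = t `^ s by near: t; exact: germ_powP.
by rewrite powRD//; apply/implyP => _; rewrite gt_eqF.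
Unshelve. all: by end_near. Qed.

Lemma germ_pow0 : germ_pow 0 = 1.
Proof.
apply: germ_eq; have := germ_powP 0; apply: filter_app; have := germ_one K.
by apply: filter_app; near=> t => -> ->; rewrite powRr0.
Unshelve. all: by end_near. Qed.

Lemma germ_nat (n : nat) : \forall t \near +oo, germ_fun (n%:R : K) t = n%:R.
Proof.
elim: n => [|n IH]; first exact: germ_zero.
have := germ_add (n%:R : K) 1; apply: filter_app; have := germ_one K.
apply: filter_app; apply: filterS IH => t nt onet.
by rewrite -!natr1 => ->; rewrite nt onet.
Qed.

(** Any positive power of t exceeds every natural number in K; this is what makes natural factors
    invisible to valuations. *)
Lemma germ_pow_natmul_le (n : nat) r s : r < s ->
  n%:R * germ_pow r <= germ_pow s.
Proof.
move=> rs; rewrite -[s](subrK r) germ_powD ler_pM2r ?germ_pow_gt0//.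
have sr : 0 < s - r by rewrite subr_gt0.
apply/germ_le; have := powR_eventually_ge n%:R sr; apply: filter_app.
have := germ_powP (s - r); apply: filter_app.
by have := germ_nat n; apply: filterS => t -> ->.
Qed.

Lemma germ_pow_le r s : r <= s -> germ_pow r <= germ_pow s.
Proof.
rewrite le_eqVlt => /orP[/eqP->//|/(germ_pow_natmul_le 1)].
by rewrite mul1r.
Qed.

Lemma germ_pow_lt r s : r < s -> germ_pow r < germ_pow s.
Proof.
move=> /(germ_pow_natmul_le 2); apply: lt_le_trans.
by rewrite ltr_pMl ?germ_pow_gt0// ltr1n.
Qed.

(* The valuation of [f >= 0], expressed by comparing [f] in [K] with the germs
   of the powers of t. *)
Definition has_val f v :=
  (forall r : R, (r%:E < v)%E -> germ_pow r <= f) /\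
  (forall r : R, (v < r%:E)%E -> f <= germ_pow r).

Lemma has_val_uniq f u v : has_val f u -> has_val f v -> u = v.
Proof.
wlog uv : u v / (u < v)%E.
  move=> h fu fv; have [uv|vu|//] := ltgtP u v; first exact: h.
  by apply/esym/h.
move=> [_ fu] [fv _]; have [r ur rv] := ereal_between uv.
have [s rs sv] := ereal_between rv; rewrite lte_fin in rs.
have := le_trans (fv _ sv) (fu _ ur).
by rewrite leNgt germ_pow_lt.
Qed.

Lemma has_val_germ_pow r : has_val (germ_pow r) r%:E.
Proof. by split=> s; rewrite lte_fin => /ltW/germ_pow_le. Qed.

Lemma has_val0 : has_val 0 -oo%E.
Proof. by split=> r // _; rewrite ltW// germ_pow_gt0. Qed.

Lemma has_val1 : has_val 1 0%E.
Proof. by rewrite -germ_pow0; exact: has_val_germ_pow. Qed.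

Lemma has_val_neq0 f v : has_val f v -> (-oo < v)%E -> f != 0.
Proof.
move=> fv v0; apply/eqP => f0; move: v0; rewrite f0 in fv.
by rewrite (has_val_uniq fv has_val0) ltxx.
Qed.

Lemma has_val_squeeze (n : nat) f g v : has_val f v ->
  f <= n%:R * g -> g <= n%:R * f -> has_val g v.
Proof.
move=> [flo fhi] fg gf; split=> r rv; have [s] := ereal_between rv.
  rewrite lte_fin => rs sv; have := le_trans (flo _ sv) fg.
  case: n fg gf => [|n] fg gf.
    by rewrite mul0r => /(lt_le_trans (germ_pow_gt0 s)); rewrite ltxx.
  move=> /(le_trans (germ_pow_natmul_le n.+1 rs)).
  by rewrite ler_pM2l// ltr0n.
move=> vs; rewrite lte_fin => sr; apply: (le_trans gf).
apply: le_trans (germ_pow_natmul_le n sr).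
by rewrite ler_wpM2l// fhi.
Qed.

Lemma has_val_add f g u v : 0 <= f -> 0 <= g -> has_val f u -> has_val g v ->
  has_val (f + g) (maxe u v).
Proof.
move=> f0 g0 [flo fhi] [glo ghi]; split => r.
  rewrite lt_max => /orP[/flo h|/glo h].
    by apply: (le_trans h); rewrite lerDl.
  by apply: (le_trans h); rewrite lerDr.
move=> /ereal_between[s]; rewrite gt_max lte_fin => /andP[us vs] sr.
apply: (le_trans _ (germ_pow_natmul_le 2 sr)).
by rewrite mulr_natl mulr2n lerD ?fhi ?ghi.
Qed.

Lemma has_val_mul f g u v : 0 <= f -> 0 <= g -> u != +oo%E -> v != +oo%E ->
  has_val f u -> has_val g v -> has_val (f * g) (u + v)%E.
Proof.
move=> f0 g0 uy vy [flo fhi] [glo ghi]; split => r.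
  case: u v uy vy flo {fhi} glo {ghi} => [u| |] [v| |]// _ _ flo glo.
  rewrite -EFinD lte_fin => ruv.
  (* The gap between [r] and [u + v] is shared equally by the two factors. *)
  have -> : r = (u - (u + v - r) / 2) + (v - (u + v - r) / 2) by field.
  rewrite germ_powD; apply: ler_pM; rewrite ?(ltW (germ_pow_gt0 _))//.
    by apply: flo; rewrite lte_fin; lra.
  by apply: glo; rewrite lte_fin; lra.
move=> uvr; suff [a [b [ua vb ->]]] :
    exists a b, [/\ (u < a%:E)%E, (v < b%:E)%E & r = a + b].
  by rewrite germ_powD ler_pM ?fhi ?ghi.
case: u v uy vy uvr {flo fhi glo ghi} => [u| |] [v| |]// _ _.
- rewrite -EFinD lte_fin => uvr.
  exists (u + (r - u - v) / 2), (v + (r - u - v) / 2).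
  by split; rewrite ?lte_fin; [lra|lra|field].
- move=> _; exists (u + 1), (r - (u + 1)); rewrite ltNyr lte_fin.
  by split => //; lra.
- move=> _; exists (r - (v + 1)), (v + 1); rewrite ltNyr lte_fin.
  by split => //; lra.
- by move=> _; exists 0, r; rewrite !ltNyr add0r.
Qed.

(** The gap between the valuations yields [2 * g <= f], so the difference lies between f / 2 and
    f. *)
Lemma has_val_dist f g u v : 0 <= g -> (v < u)%E -> has_val f u -> has_val g v ->
  has_val `|f - g| u.
Proof.
move=> g0 vu fu gv; have [s vs /ereal_between[s' ss' s'u]] := ereal_between vu.
rewrite lte_fin in ss'.
have gf : 2 * g <= f.
  apply: le_trans (fu.1 _ s'u); apply: le_trans (germ_pow_natmul_le 2 ss').
  by rewrite ler_pM2l// gv.2.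
apply: (has_val_squeeze (n := 2) fu); rewrite ger0_norm; lra.
Qed.

Lemma has_val_sum (I : finType) (P : pred I) (f : I -> K) (v : I -> \bar R) :
  (forall i, P i -> 0 <= f i) -> (forall i, P i -> has_val (f i) (v i)) ->
  has_val (\sum_(i | P i) f i) (\big[maxe/-oo%E]_(i | P i) v i).
Proof.
move=> f0 fv; suff [] : 0 <= \sum_(i | P i) f i /\
  has_val (\sum_(i | P i) f i) (\big[maxe/-oo%E]_(i | P i) v i) by [].
elim/big_ind2: _ => [|a u b w [a0 av] [b0 bv]|i Pi].
- by split=> //; exact: has_val0.
- by split; [exact: addr_ge0|exact: has_val_add].
- by split; [exact: f0|exact: fv].
Qed.

Lemma has_val_prod (I : finType) (f : I -> K) (v : I -> \bar R) :
  (forall i, 0 <= f i) -> (forall i, v i != +oo%E) ->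
  (forall i, has_val (f i) (v i)) ->
  has_val (\prod_i f i) (\sum_i v i)%E.
Proof.
move=> f0 vy fv; suff [_ _ //] : [/\ 0 <= \prod_i f i, (\sum_i v i != +oo)%E &
  has_val (\prod_i f i) (\sum_i v i)%E].
have addNy (x y : \bar R) : (x != +oo -> y != +oo -> x + y != +oo)%E.
  by case: x y => [x| |] [y| |].
elim/big_ind2: _ => [|a u b w [a0 uy av] [b0 wy bv]|i _].
- by split=> //; exact: has_val1.
- by split; [exact: mulr_ge0|exact: addNy|exact: has_val_mul].
- by split.
Qed.

Lemma has_val_growth f v : 0 <= f -> has_val f v ->
  growth (fun t => `|germ_fun f t|%:E) v.
Proof.
move=> f0 [flo fhi]; split=> r.
  move=> /flo/germ_le; apply: filter_app; have := germ_powP r; apply: filter_app.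
  by near=> t => -> h; rewrite lee_fin (le_trans h)// ler_norm.
move=> /fhi/germ_le; apply: filter_app; have := germ_powP r; apply: filter_app.
have /germ_le := f0; apply: filter_app; have := germ_zero; apply: filter_app.
by near=> t => -> h -> h'; rewrite lee_fin ger0_norm.
Unshelve. all: by end_near. Qed.

Lemma has_val_valuation_eq f v : 0 <= f -> has_val f v -> valuation f = v.
Proof.
move=> f0 fv; apply: cvg_lim; first exact: ereal_hausdorff.
by apply: growth_cvg => [t|]; [rewrite lee_fin|exact: has_val_growth].
Qed.

(* K is totally ordered, so every f >= 0 cuts the scale of powers. *)
Lemma has_val_valuation f : 0 <= f -> has_val f (valuation f).
Proof.
move=> f0; pose v := ereal_sup [set r%:E | r in [set r : R | germ_pow r <= f]].
suff fv : has_val f v by rewrite (has_val_valuation_eq f0 fv).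
split=> r.
  move=> /ereal_sup_gt[_ [s /= sf <-]]; rewrite lte_fin => /ltW/germ_pow_le.
  by move=> /le_trans; apply.
move=> vr; rewrite leNgt; apply/negP => /ltW rf; move: vr; rewrite ltNge.
by move=> /negP; apply; apply: ereal_sup_ubound; exists r.
Qed.
End Valuation.

(** * Tropical minors *)

(** Sign genericity concerns increasing selections of columns; this brings the enumeration used in
    [abs_det] under it. *)
Lemma enum_val_homo (m : nat) (J : {set 'I_m}) :
  {homo (@enum_val _ (mem J)) : i j / (i < j)%N}.
Proof.
have srt : sorted (relpre val ltn) (enum J).
  rewrite (_ : enum J = [seq i <- enum 'I_m | i \in J]); last first.
    by rewrite /enum_mem filter_predT.
  apply: sorted_filter; first by move=> a b c; exact: ltn_trans.
  by rewrite -sorted_map val_enum_ord iota_ltn_sorted.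
move=> i j ij; have x0 : 'I_m := enum_val i; rewrite !(enum_val_nth x0).
apply: (sorted_ltn_nth _ _ srt) => //; rewrite ?inE -?cardE//.
by move=> a b c; exact: ltn_trans.
Qed.

Section TropicalMinors.
Variables (R : realType) (S : set_structure R) (K : hardy_field S).

Lemma le_trop_det n (C : 'M[\bar R]_n) s : (trop_weight C s <= trop_det C)%E.
Proof. exact: le_bigmax_cond. Qed.

(** The even and the odd terms are collected in two sums of nonnegative germs, in which nothing
    cancels. All maximizing permutations have one parity, so one sum strictly dominates the
    other. *)
Lemma has_val_det n (N : 'M[K]_n) (C : 'M[\bar R]_n) :
  (forall i j, 0 <= N i j) -> (forall i j, C i j != +oo%E) ->
  (forall i j, has_val (N i j) (C i j)) ->
  (forall s1 s2 : 'S_n, trop_weight C s1 = trop_det C ->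
    trop_weight C s2 = trop_det C -> odd_perm s1 = odd_perm s2) ->
  (-oo < trop_det C)%E ->
  has_val `|\det N| (trop_det C).
Proof.
move=> N0 Cy NC par detC.
pose P b := \sum_(s : 'S_n | odd_perm s == b) \prod_i N i (s i).
pose U b := \big[maxe/-oo%E]_(s : 'S_n | odd_perm s == b) trop_weight C s.
have PU b : has_val (P b) (U b).
  apply: has_val_sum => s _; first by apply: prodr_ge0.
  exact: has_val_prod.
have P0 b : 0 <= P b by apply: sumr_ge0 => s _; apply: prodr_ge0.
have detE : \det N = P false - P true.
  rewrite /determinant (bigID (fun s : 'S_n => odd_perm s == false)) /=.
  congr (_ + _).
    by apply: eq_bigr => s /eqP ->; rewrite expr0 mul1r.
  rewrite -sumrN; apply: eq_big => s; first by case: (odd_perm s).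
  by case: (odd_perm s) => // _; rewrite expr1 mulN1r.
have [s0 _ s0E] : {s0 : 'S_n | true & trop_det C = trop_weight C s0}.
  by apply: (@eq_bigmax _ _ _ _ 1%g) => // s _; rewrite leNye.
have Us0 : U (odd_perm s0) = trop_det C.
  apply/eqP; rewrite eq_le; apply/andP; split.
    by apply: bigmax_le => [|s _]; [rewrite leNye|exact: le_trop_det].
  by rewrite s0E; apply: le_bigmax_cond.
have Us1 : (U (~~ odd_perm s0) < trop_det C)%E.
  (* [detC] covers the default value -oo of the maximum, in particular when no permutation has the
     other parity. *)
  apply: bigmax_lt => // s sP; rewrite lt_neqAle le_trop_det andbT.
  apply/eqP => sE; move: sP; rewrite (par s s0)//; by case: (odd_perm s0).
have PU0 := PU (odd_perm s0); rewrite Us0 in PU0.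
rewrite detE; case: (odd_perm s0) PU0 Us1 => PU0 Us1.
  by rewrite distrC; apply: (has_val_dist _ Us1).
exact: (has_val_dist _ Us1).
Qed.

Lemma sign_generic_colsub d m (B : 'M[\bar R]_(1 + d, m)) (h : 'I_(1 + d) -> 'I_m) :
  tropically_sign_generic B -> (1 + d <= m)%N -> {homo h : i j / (i < j)%N} ->
  forall s1 s2 : 'S_(1 + d), trop_weight (colsub h B) s1 = trop_det (colsub h B) ->
  trop_weight (colsub h B) s2 = trop_det (colsub h B) -> odd_perm s1 = odd_perm s2.
Proof.
move=> + dm; rewrite /tropically_sign_generic.
have : minn (1 + d) m = (1 + d)%N by apply/minn_idPl.
move: (minn _ _) => n en; subst n => gen hh.
by apply: (gen id h).
Qed.

(** If the tropical determinant were -oo, every permutation would attain it, including the identity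
    and a transposition, of opposite parities. For [d = 0] the only entry is the 0 of the top
    row. *)
Lemma trop_det_bar_gt d m (A : 'M[\bar R]_(d, m)) (h : 'I_(1 + d) -> 'I_m) :
  let C := colsub h (trop_bar_mx A) in
  (forall s1 s2 : 'S_(1 + d), trop_weight C s1 = trop_det C ->
    trop_weight C s2 = trop_det C -> odd_perm s1 = odd_perm s2) ->
  (-oo < trop_det C)%E.
Proof.
move=> C par; rewrite ltNye; apply/eqP => CN.
have all s : trop_weight C s = trop_det C.
  by apply/eqP; rewrite CN -leeNy_eq -CN le_trop_det.
case: d A h @C par CN all => [|d] A h C par CN all.
  have := all 1%g; rewrite CN /trop_weight big_ord1 !mxE.
  by case: splitP => [j _|[]//]; rewrite mxE.
have := par 1%g (tperm ord0 ord_max) (all _) (all _).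
by rewrite odd_perm1 odd_tperm.
Qed.

Definition trop_abs_det d m (A : 'M[\bar R]_(d, m)) (J : {set 'I_m}) : \bar R :=
  match #|J| =P (1 + d)%N with
  | ReflectT eqJ =>
      trop_det (colsub (fun k => enum_val (cast_ord (esym eqJ) k)) (trop_bar_mx A))
  | ReflectF _ => -oo%E
  end.

Lemma has_val_bar_mx d m (A : 'M[\bar R]_(d, m)) (M : 'M[K]_(d, m)) i j :
  lifts K A M -> 0 <= bar_mx M i j /\ has_val (bar_mx M i j) (trop_bar_mx A i j).
Proof.
move=> MA; rewrite /bar_mx /trop_bar_mx !mxE; case: splitP => k _.
  by rewrite !mxE; split => //; exact: has_val1.
by have [M0 <-] := MA k j; split => //; exact: has_val_valuation.
Qed.

Lemma has_val_abs_det d m (A : 'M[\bar R]_(d, m)) (M : 'M[K]_(d, m)) J :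
  tropical_mx A -> tropically_sign_generic (trop_bar_mx A) -> lifts K A M ->
  has_val (abs_det M J) (trop_abs_det A J) /\
  (#|J| = (1 + d)%N -> (-oo < trop_abs_det A J)%E).
Proof.
move=> Ay gen MA; rewrite /abs_det /trop_abs_det.
case: eqP => [cJ|cJ]; last by split=> [|/cJ//]; exact: has_val0.
have dm : (1 + d <= m)%N by rewrite -cJ -[m in leqRHS]card_ord max_card.
pose h (k : 'I_(1 + d)) : 'I_m := enum_val (cast_ord (esym cJ) k).
have hh : {homo h : i j / (i < j)%N}.
  by move=> i j ij; exact: (@enum_val_homo _ J (cast_ord _ i) (cast_ord _ j)).
have par := sign_generic_colsub gen dm hh.
have det_gt := trop_det_bar_gt par.
split=> //; apply: has_val_det => // i j; rewrite mxE.
- by have [] := has_val_bar_mx i (h j) MA.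
- rewrite /trop_bar_mx mxE; case: splitP => k _; last exact: Ay.
  by rewrite mxE.
- have -> : colsub h (trop_bar_mx A) i j = trop_bar_mx A i (h j) by rewrite mxE.
  by have [] := has_val_bar_mx i (h j) MA.
Qed.

Lemma lift_general_position d m (A : 'M[\bar R]_(d, m)) (M : 'M[K]_(d, m)) :
  tropical_mx A -> tropically_sign_generic (trop_bar_mx A) -> lifts K A M ->
  general_position M.
Proof.
move=> Ay gen MA f fI; rewrite -normr_eq0 -abs_det_imset//.
have [fv] := has_val_abs_det [set f i | i : 'I_(1 + d)]%SET Ay gen MA.
rewrite card_imset// card_ord => /(_ erefl); exact: has_val_neq0 fv.
Qed.

Lemma has_val_sum_abs_det d m (A : 'M[\bar R]_(d, m)) (M : 'M[K]_(d, m)) :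
  tropical_mx A -> tropically_sign_generic (trop_bar_mx A) -> lifts K A M ->
  has_val (\sum_J abs_det M J) (\big[maxe/-oo%E]_J trop_abs_det A J).
Proof.
move=> Ay gen MA; apply: has_val_sum => J _; first exact: abs_det_ge0.
by have [] := has_val_abs_det J Ay gen MA.
Qed.

Lemma valuation_vol d m (A : 'M[\bar R]_(d, m)) (M : 'M[K]_(d, m)) :
  tropical_mx A -> tropically_sign_generic (trop_bar_mx A) -> lifts K A M ->
  valuation (vol M) = \big[maxe/-oo%E]_J trop_abs_det A J.
Proof.
move=> Ay gen MA; apply: has_val_valuation_eq; first exact: vol_ge0.
have [n Dn] := sum_abs_det_le_vol (lift_general_position Ay gen MA).
(* One factor has to serve both inequalities, and the reverse one asks for at least 1; hence the
   successor. *)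
apply: (has_val_squeeze (n := n.+1) (has_val_sum_abs_det Ay gen MA)).
  by apply: (le_trans Dn); rewrite ler_wpM2r ?vol_ge0// ler_nat.
apply: (le_trans (vol_le M)); rewrite ler_peMl ?ler1n//.
by apply: sumr_ge0 => J _; exact: abs_det_ge0.
Qed.

(** The monomial lift takes powers of t as entries. Over an empty set of lifts the supremum and the
    infimum would be -oo and +oo. *)
Lemma lifts_nonempty d m (A : 'M[\bar R]_(d, m)) : tropical_mx A ->
  exists M : 'M[K]_(d, m), lifts K A M.
Proof.
move=> Ay.
exists (\matrix_(i, j) if A i j is r%:E then germ_pow K r else 0) => i j.
rewrite mxE; have := Ay i j; case: (A i j) => [r| |]// _.
  have r0 := ltW (germ_pow_gt0 K r); split => //.
  by apply: has_val_valuation_eq => //; exact: has_val_germ_pow.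
by split => //; apply: has_val_valuation_eq => //; exact: has_val0.
Qed.
End TropicalMinors.

(** * Evaluation of germs at large t *)

Section Evaluation.
Variables (R : realType) (S : set_structure R) (K : hardy_field S).

Definition germ_of (f : K) (g : R -> R) := \forall t \near +oo, germ_fun f t = g t.

Lemma germ_of_sum (I : finType) (P : pred I) (f : I -> K) (g : I -> R -> R) :
  (forall i, germ_of (f i) (g i)) ->
  germ_of (\sum_(i | P i) f i) (fun t => \sum_(i | P i) g i t).
Proof.
move=> fg; rewrite /germ_of; elim: (index_enum I) => [|i s IH].
  by apply: filterS (germ_zero K) => t; rewrite !big_nil.
case Pi : (P i); last by apply: filterS IH => t; rewrite !big_cons Pi.
have := germ_add (f i) (\sum_(i <- s | P i) f i); apply: filter_app.
have := fg i; apply: filter_app; apply: filterS IH => t h1 h2.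
by rewrite !big_cons Pi h1 h2.
Qed.

Lemma germ_of_prod (I : finType) (f : I -> K) (g : I -> R -> R) :
  (forall i, germ_of (f i) (g i)) ->
  germ_of (\prod_i f i) (fun t => \prod_i g i t).
Proof.
move=> fg; rewrite /germ_of; elim: (index_enum I) => [|i s IH].
  by apply: filterS (germ_one K) => t; rewrite !big_nil.
have := germ_mul (f i) (\prod_(i <- s) f i); apply: filter_app.
have := fg i; apply: filter_app; apply: filterS IH => t h1 h2.
by rewrite !big_cons h1 h2.
Qed.

Lemma germ_of_det n (N : 'M[K]_n) (G : R -> 'M[R]_n) :
  (forall i j, germ_of (N i j) (fun t => G t i j)) ->
  germ_of (\det N) (fun t => \det (G t)).
Proof.
move=> NG; apply: germ_of_sum => s.
have Ns : germ_of (\prod_i N i (s i)) (fun t => \prod_i G t i (s i)).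
  by apply: germ_of_prod => i; exact: NG.
case: (odd_perm s); apply: filterS2 Ns (germ_opp (\prod_i N i (s i))) => t h' h.
  by rewrite expr1 !mulN1r h h'.
by rewrite expr0 !mul1r.
Qed.

Lemma germ_of_sum_abs_det d m (M : 'M[K]_(d, m)) :
  germ_of (\sum_J abs_det M J) (fun t => \sum_J abs_det (eval_mx M t) J).
Proof.
apply: germ_of_sum => J; rewrite /abs_det; case: eqP => cJ; last exact: germ_zero.
pose h (k : 'I_(1 + d)) : 'I_m := enum_val (cast_ord (esym cJ) k).
have : germ_of (\det (colsub h (bar_mx M)))
    (fun t => \det (colsub h (bar_mx (eval_mx M t)))).
  have colE (F : Type) (B : 'M[F]_(1 + d, m)) i j : colsub h B i j = B i (h j).
    by rewrite mxE.
  apply: germ_of_det => i j; rewrite /germ_of.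
  case: (split_ordP i) => k ->.
    apply: filterS (germ_one K) => t.
    by rewrite !colE /bar_mx !col_mxEu !mxE.
  by apply: nearW => t; rewrite !colE /bar_mx !col_mxEd mxE.
apply: filter_app; have := germ_norm (\det (colsub h (bar_mx M))).
by apply: filterS => t -> ->.
Qed.

(** An intermediate exponent [s] leaves a spare positive power of t, which eventually exceeds
    [c^-1], respectively [C]. *)
Lemma growth_squeeze (y : R -> R) (z : R -> \bar R) (c C : R) (v : \bar R) :
  0 < c -> 0 < C ->
  (\forall t \near +oo, ((c * y t)%:E <= z t <= (C * y t)%:E)%E) ->
  growth (fun t => (y t)%:E) v -> growth z v.
Proof.
move=> c0 C0 h [ylo yhi]; split=> r.
  move=> /ereal_between[s]; rewrite lte_fin => rs /ylo.
  apply: filter_app; move: h; apply: filter_app.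
  have sr : 0 < s - r by rewrite subr_gt0.
  have := powR_eventually_ge c^-1 sr; apply: filter_app; near=> t.
  have t0 : 0 < t by near: t; exact: nbhs_pinfty_gt.
  move=> cs /andP[cz _]; rewrite lee_fin => ys; apply: le_trans cz.
  rewrite lee_fin; apply: le_trans (ler_wpM2l (ltW c0) ys).
  have -> : t `^ s = t `^ (s - r) * t `^ r.
    by rewrite -powRD ?subrK//; apply/implyP => _; rewrite gt_eqF.
  rewrite mulrA ler_peMl ?powR_ge0//.
  by rewrite mulrC -ler_pdivrMr// div1r.
move=> /ereal_between[s vs]; rewrite lte_fin => sr; move: vs => /yhi.
apply: filter_app; move: h; apply: filter_app.
have rs : 0 < r - s by rewrite subr_gt0.
have := powR_eventually_ge C rs; apply: filter_app; near=> t.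
have t0 : 0 < t by near: t; exact: nbhs_pinfty_gt.
move=> Cs /andP[_ zC]; rewrite lee_fin => ys; apply: (le_trans zC).
rewrite lee_fin; apply: (le_trans (ler_wpM2l (ltW C0) ys)).
have -> : t `^ r = t `^ (r - s) * t `^ s.
  by rewrite -powRD ?subrK//; apply/implyP => _; rewrite gt_eqF.
by rewrite ler_wpM2r ?powR_ge0.
Unshelve. all: by end_near. Qed.

Lemma euclidean_vol_ge0 d (X : set 'cV[R]_d) : (0 <= euclidean_vol X)%E.
Proof.
apply/ereal_infP => _ [D [a [b [_ ->]]]].
by apply: esum_ge0 => k _; rewrite lee_fin box_vol_ge0.
Qed.

Lemma euclidean_vol_growth d m (M : 'M[K]_(d, m)) (v : \bar R) :
  general_position M -> has_val (\sum_J abs_det M J) v ->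
  growth (fun t => euclidean_vol (hull (eval_mx M t) [set: 'I_m]%SET)) v.
Proof.
move=> gp Dv; have D0 : 0 <= \sum_J abs_det M J.
  by apply: sumr_ge0 => J _; exact: abs_det_ge0.
have [c c0 lo] := euclidean_vol_hull_ge R d m.
have [C C0 hi] := euclidean_vol_hull_le R d m.
apply: (growth_squeeze c0 C0 _ (has_val_growth D0 Dv)).
(* A nonzero germ is eventually nonzero at t: its product with the germ of its inverse is eventually
   1. *)
have DN : \forall t \near +oo,
    (germ_fun (\sum_J abs_det M J) t != 0) || (m < 1 + d)%N.
  have [dm|dm] := ltnP m (1 + d); first by apply: nearW => t; rewrite orbT.
  have fI : injective (widen_ord dm) by move=> a b /(congr1 val) ab; exact: val_inj.
  have DN0 : \sum_J abs_det M J != 0.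
    rewrite gt_eqF// (bigD1 [set widen_ord dm i | i : 'I_(1 + d)]%SET)//=.
    rewrite ltr_pwDl ?abs_det_imset ?normr_gt0 ?gp//.
    by apply: sumr_ge0 => J _; exact: abs_det_ge0.
  have := germ_mul (\sum_J abs_det M J) (\sum_J abs_det M J)^-1.
  rewrite divff//; apply: filter_app; apply: filterS (germ_one K) => t ->.
  by case: eqP => // ->; rewrite mul0r => /eqP; rewrite oner_eq0.
move: DN; apply: filter_app; have := germ_of_sum_abs_det M; apply: filter_app.
near=> t => E; rewrite E => DN.
have S0 : 0 <= \sum_J abs_det (eval_mx M t) J.
  by apply: sumr_ge0 => J _; exact: abs_det_ge0.
by rewrite ger0_norm// lo hi.
Unshelve. all: by end_near. Qed.
End Evaluation.

Theorem mainTheorem8 (R : realType) (S : set_structure R)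
    (S_omin : o_minimal S) (S_pbd : polynomially_bounded S)
    (K : hardy_field S) (d m : nat) (A : 'M[\bar R]_(d, m))
    (A_trop : tropical_mx A)
    (A_generic : tropically_sign_generic (trop_bar_mx A)) :
  qvol_sup K A = qvol_inf K A /\
  forall M : 'M[K]_(d, m), lifts K A M ->
    log_ratio (euclidean_vol (hull (eval_mx M t) [set: 'I_m]%SET)) t
      @[t --> +oo] --> qvol_sup K A.
Proof.
pose v := (\big[maxe/-oo]_J trop_abs_det A J)%E.
have valE M : lifts K A M -> valuation (vol M) = v.
  exact: valuation_vol.
have [M0 M0A] := lifts_nonempty K A_trop.
have valsE : [set valuation (vol M) | M in lifts K A] = [set v].
  apply/seteqP; split => [_ [M /valE vM <-] //|_ ->].
  by exists M0 => //; exact: valE.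
rewrite /qvol_sup /qvol_inf valsE ereal_sup1 ereal_inf1; split=> // M MA.
apply: growth_cvg => [t|]; first exact: euclidean_vol_ge0.
apply: euclidean_vol_growth; first exact: lift_general_position MA.
exact: has_val_sum_abs_det.
Qed.
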